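(* Let $\eta>0$ be a constant such that $\|B(u,v)\|_{\mathcal X}\le\eta\|u\|_{\mathcal X}\|v\|_{\mathcal X}$ for all $u,v\in\mathcal X=\mathcal C_w([0,\infty),\mathcal{PM}^2)$ (such a constant exists), and let $0<\varepsilon<1/(4\eta)$. Let $F\in\mathcal{PM}$ (independent of time) satisfy $\|F\|_{\mathcal{PM}}<\varepsilon$, and let $u_\infty\in\mathcal{PM}^2$ be the unique stationary solution of the Navier--Stokes system with external force $F$ satisfying $\|u_\infty\|_{\mathcal{PM}^2}\le2\varepsilon$. Suppose that $v_0\in\mathcal{PM}^2$ and $G\in\mathcal C_w([0,\infty),\mathcal{PM})$ satisfy $\|v_0\|_{\mathcal{PM}^2}+\|G\|_{\mathcal C_w([0,\infty),\mathcal{PM})}\le\varepsilon$ and, moreover, $$\lim_{t\to\infty}\|S(t)(v_0-u_\infty)\|_{\mathcal{PM}^2}=0,\qquad\lim_{t\to\infty}\|G(t)-F\|_{\mathcal{PM}}=0.$$ Then the solution $v=v(x,t)$ of the Navier--Stokes problem corresponding to $v_0$ and $G$ (the unique one with $\|v\|_{\mathcal X}\le2\varepsilon$) converges toward the stationary solution $u_\infty$ in the sense that $$\lim_{t\to\infty}\|v(t)-u_\infty\|_{\mathcal{PM}^2}=0.$$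
   Context: The Fourier transform on $\mathbb{R}^3$ is $\widehat v(\xi)=(2\pi)^{-3/2}\int_{\mathbb{R}^3}e^{-ix\cdot\xi}v(x)\,dx$, extended to tempered distributions. For $a\ge0$, $\mathcal{PM}^a=\{v\in\mathcal S'(\mathbb{R}^3):\widehat v\in L^1_{loc}(\mathbb{R}^3),\ \|v\|_{\mathcal{PM}^a}=\operatorname{ess\,sup}_{\xi\in\mathbb{R}^3}|\xi|^a|\widehat v(\xi)|<\infty\}$, and $\mathcal{PM}=\mathcal{PM}^0$. The same notation is used for vector-valued $v=(v_1,v_2,v_3)$, with $|\widehat v(\xi)|$ the Euclidean norm. All data, forces and solutions are vector valued with three components. $\mathcal C_w([0,\infty),\mathcal{PM}^a)$ is the space of bounded functions $u:[0,\infty)\to\mathcal{PM}^a$ that are weakly continuous as distributions ($t\mapsto\langle u(t),\varphi\rangle$ is continuous for every Schwartz function $\varphi$), with norm $\sup_{t\ge0}\|u(t)\|_{\mathcal{PM}^a}$. $S(t)$ is the heat semigroup, $\widehat{S(t)v}(\xi)=e^{-t|\xi|^2}\widehat v(\xi)$. $\mathbb{P}$ is the Leray projector, with matrix symbol $(\widehat{\mathbb{P}}(\xi))_{j,k}=\delta_{jk}-\xi_j\xi_k/|\xi|^2$. For $u,v\in\mathcal{PM}^2$, $\widehat{u_kv_j}=(2\pi)^{-3/2}\,\widehat u_k*\widehat v_j$, $u\otimes v$ is the matrix with entries $u_kv_j$, and $i\xi\cdot\widehat{(u\otimes v)}$ is the vector with $j$-th component $\sum_k i\xi_k\widehat{u_kv_j}$.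 The bilinear operator $B$ is defined by $\widehat{B(u,v)}(\xi,t)=-\int_0^te^{-(t-\tau)|\xi|^2}\widehat{\mathbb{P}}(\xi)\,i\xi\cdot\widehat{(u\otimes v)}(\xi,\tau)\,d\tau$. The Navier--Stokes problem is $v_t-\Delta v+(v\cdot\nabla)v+\nabla p=G$, $\nabla\cdot v=0$, $v(0)=v_0$ on $\mathbb{R}^3$. By a solution corresponding to $(v_0,G)$ we mean $v\in\mathcal C_w([0,\infty),\mathcal{PM}^2)$ such that for all $t\ge0$ $$\widehat v(\xi,t)=e^{-t|\xi|^2}\widehat v_0(\xi)-\int_0^te^{-(t-\tau)|\xi|^2}\widehat{\mathbb{P}}(\xi)\,i\xi\cdot\widehat{(v\otimes v)}(\xi,\tau)\,d\tau+\int_0^te^{-(t-\tau)|\xi|^2}\widehat{\mathbb{P}}(\xi)\widehat G(\xi,\tau)\,d\tau .$$ A stationary solution with time-independent force $F\in\mathcal{PM}$ is $u\in\mathcal{PM}^2$ which, as a constant function of $t$, is a solution corresponding to $(u,F)$; equivalently, for almost every $\xi$, $\widehat u(\xi)=-|\xi|^{-2}\widehat{\mathbb{P}}(\xi)\,i\xi\cdot\widehat{(u\otimes u)}(\xi)+|\xi|^{-2}\widehat{\mathbb{P}}(\xi)\widehat F(\xi)$. Under the smallness conditions above, the solutions $u_\infty$ and $v$ exist and are unique in the indicated balls. *)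

(* Defs.v *)
From HB Require Import structures.
From mathcomp Require Import all_boot all_order all_algebra.
From mathcomp Require Import all_classical all_reals all_analysis.
From mathcomp Require Import ess_sup_inf complex.

Set Implicit Arguments.
Unset Strict Implicit.
Unset Printing Implicit Defensive.

Import Order.TTheory GRing.Theory Num.Theory.
Import numFieldNormedType.Exports.

Local Open Scope classical_set_scope.
Local Open Scope ring_scope.
Local Open Scope complex_scope.

(* The projections of [R[i]]; the bare names denote the operations of an
   arbitrary numClosedFieldType, which are valued in that field. *)
Local Notation Re := complex.Re.
Local Notation Im := complex.Im.

Section Space.
Variable R : realType.

Definition space := (R * R * R)%type.

Definition mu3 :
    {measure set (measurableTypeR R * measurableTypeR R * measurableTypeR R)%type
       -> \bar R} :=
  ((@lebesgue_measure R \x @lebesgue_measure R)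
     \x @lebesgue_measure R)%E.

Definition coord (x : space) (j : 'I_3) : R :=
  tnth [tuple x.1.1; x.1.2; x.2] j.

Definition unitv (j : 'I_3) : space :=
  ((j == 0%N :> nat)%:R, (j == 1%N :> nat)%:R, (j == 2%N :> nat)%:R).

Definition dot (x y : space) : R := \sum_(j < 3) coord x j * coord y j.

(* The library norm on [R * R * R] is the sup norm, not the Euclidean one. *)
Definition enorm (x : space) : R := Num.sqrt (dot x x).

Definition cfun := space -> R[i].
Definition cvfun := space -> 'I_3 -> R[i].

Definition cnorm (z : 'I_3 -> R[i]) : R :=
  Num.sqrt (\sum_(j < 3) (Re (z j) ^+ 2 + Im (z j) ^+ 2)).

Definition cintegral d (T : measurableType d)
    (mu : {measure set T -> \bar R}) (D : set T) (f : T -> R[i]) : R[i] :=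
  Rintegral mu D (fun x => Re (f x)) +i* Rintegral mu D (fun x => Im (f x)).

Definition cexpi (x : R) : R[i] := cos x +i* sin x.

Definition fourier_const : R[i] := ((2 * pi) `^ (- (3 / 2)))%:C.

Definition fourier (phi : cfun) : cfun := fun xi =>
  fourier_const * cintegral mu3 setT (fun x => cexpi (- dot x xi) * phi x).

End Space.

Section Distributions.
Variable R : realType.
Local Notation space := (space R).
Local Notation cfun := (cfun R).

Definition partial (j : 'I_3) (f : cfun) : cfun := fun x =>
  'D_(unitv R j) (fun y => Re (f y)) x +i* 'D_(unitv R j) (fun y => Im (f y)) x.

Definition partials (s : seq 'I_3) (f : cfun) : cfun := foldr partial f s.

Definition smooth (f : cfun) : Prop :=
  forall (s : seq 'I_3) (j : 'I_3) (x : space),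
    derivable (fun y => Re (partials s f y)) x (unitv R j) /\
    derivable (fun y => Im (partials s f y)) x (unitv R j).

Definition seminorm (N : nat) (f : cfun) : \bar R :=
  ereal_sup [set r | exists (s : seq 'I_3) (x : space), (size s <= N)%N /\
    r = ((1 + enorm x) ^+ N * ComplexField.Normc.normc (partials s f x))%:E].

(* Existence of all iterated partial derivatives together with their
   boundedness gives their continuity, so [f] is C^infinity. *)
Definition schwartz (f : cfun) : Prop :=
  smooth f /\ forall N, (seminorm N f < +oo)%E.

(* Only the values of a functional on Schwartz functions are meaningful. *)
Definition functional := cfun -> R[i].

Definition tempered (T : functional) : Prop :=
  (forall (c : R[i]) (phi psi : cfun), schwartz phi -> schwartz psi ->
    T (fun x => c * phi x + psi x) = c * T phi + T psi) /\
  (exists (N : nat) (C : R), forall phi, schwartz phi ->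
    ((ComplexField.Normc.normc (T phi))%:E <= C%:E * seminorm N phi)%E).

Definition loc_integrable (f : cfun) : Prop :=
  forall K : set space, compact K ->
    (mu3 R).-integrable K (fun x => (Re (f x))%:E) /\
    (mu3 R).-integrable K (fun x => (Im (f x))%:E).

(* The Fourier transform of [T], defined by duality, is the function [g]. *)
Definition fourier_of (T : functional) (g : cfun) : Prop :=
  forall phi, schwartz phi ->
    T (fourier phi) = cintegral (mu3 R) setT (fun xi => g xi * phi xi).

End Distributions.

Section PseudoMeasures.
Variable R : realType.
Local Notation space := (space R).
Local Notation cvfun := (cvfun R).

Definition pm_norm (a : R) (g : cvfun) : \bar R :=
  ess_sup (mu3 R) (fun xi => (enorm xi `^ a * cnorm (g xi))%:E).

(* An element of PM^a is a vector of tempered distributions bundled with a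
   function representing its Fourier transform; that function is determined
   by the distributions up to a null set. *)
Record PM (a : R) := MkPM {
  dist : 'I_3 -> functional R;
  hat : cvfun;
  pm_tempered : forall j, tempered (dist j);
  pm_loc_integrable : forall j, loc_integrable (fun xi => hat xi j);
  pm_fourier : forall j, fourier_of (dist j) (fun xi => hat xi j);
  pm_finite : (pm_norm a hat < +oo)%E }.

Definition hats (a : R) (u : R -> PM a) : R -> cvfun := fun t => hat (u t).

(* C_w([0,oo), PM^a); the values at negative times are irrelevant.  The Fourier
   transforms of a weakly continuous family have representatives that are
   jointly measurable in (t, xi); the last clause says that such
   representatives are chosen, without which time integrals of [hat (u t) xi]
   at fixed xi would depend on the choice made for each t separately. *)
Definition Cw (a : R) (u : R -> PM a) : Prop :=
  [/\ exists M : R, forall t, 0 <= t -> (pm_norm a (hat (u t)) <= M%:E)%E,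
      forall (j : 'I_3) (phi : cfun R), schwartz phi ->
        {within `[0, +oo[, continuous (fun t => Re (dist (u t) j phi))} /\
        {within `[0, +oo[, continuous (fun t => Im (dist (u t) j phi))} &
      forall j : 'I_3,
        measurable_fun [set p : R * space | 0 <= p.1]
          (fun p : R * space => Re (hat (u p.1) p.2 j)) /\
        measurable_fun [set p : R * space | 0 <= p.1]
          (fun p : R * space => Im (hat (u p.1) p.2 j))].

Definition Cw_norm (a : R) (g : R -> cvfun) : \bar R :=
  ereal_sup [set pm_norm a (g t) | t in `[0, +oo[].

(* Fourier side of v - w. *)
Definition subv (g h : cvfun) : cvfun := fun xi j => g xi j - h xi j.

Definition heat_symbol (t : R) (xi : space) : R[i] :=
  (expR (- t * enorm xi ^+ 2))%:C.

(* Fourier side of S(t) v. *)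
Definition heat (t : R) (g : cvfun) : cvfun := fun xi j =>
  heat_symbol t xi * g xi j.

Definition leray_symbol (xi : space) (j k : 'I_3) : R :=
  (j == k)%:R - coord xi j * coord xi k / enorm xi ^+ 2.

(* Fourier side of P v. *)
Definition leray (g : cvfun) : cvfun := fun xi j =>
  \sum_(k < 3) (leray_symbol xi j k)%:C * g xi k.

(* The Fourier transform of u_k v_j, where g and h are those of u and v. *)
Definition tensor_hat (g h : cvfun) (k j : 'I_3) : cfun R := fun xi =>
  fourier_const R *
    cintegral (mu3 R) setT (fun y : space => g (xi - y) k * h y j).

(* i xi . (u (x) v)^ *)
Definition div_tensor_hat (g h : cvfun) : cvfun := fun xi j =>
  \sum_(k < 3) (0 +i* coord xi k) * tensor_hat g h k j xi.

(* int_0^t e^{-(t-tau)|xi|^2} P^(xi) f(xi, tau) dtau *)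
Definition duhamel (f : R -> cvfun) (t : R) : cvfun := fun xi j =>
  cintegral (@lebesgue_measure R) `[0, t]
    (fun tau => heat_symbol (t - tau) xi * leray (f tau) xi j).

(* The Fourier transform of B(u,v)(t), where g and h are those of u and v. *)
Definition bilin_hat (g h : R -> cvfun) (t : R) : cvfun := fun xi j =>
  - duhamel (fun tau => div_tensor_hat (g tau) (h tau)) t xi j.

(* [eta] bounds the bilinear operator B on C_w([0,oo), PM^2). *)
Definition bilin_bound (eta : R) : Prop :=
  forall u v : R -> PM 2, Cw u -> Cw v ->
    (Cw_norm 2 (bilin_hat (hats u) (hats v)) <=
       eta%:E * (Cw_norm 2 (hats u) * Cw_norm 2 (hats v)))%E.

Definition ns_solution (v0 : PM 2) (G : R -> PM 0) (v : R -> PM 2) : Prop :=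
  Cw v /\
  forall t, 0 <= t -> {ae mu3 R, forall xi, forall j : 'I_3,
    hat (v t) xi j = heat t (hat v0) xi j
      + bilin_hat (hats v) (hats v) t xi j
      + duhamel (hats G) t xi j}.

Definition ns_stationary (F : PM 0) (u : PM 2) : Prop :=
  ns_solution u (fun=> F) (fun=> u).

End PseudoMeasures.

(* Main.v *)
Require Import Defs.
From HB Require Import structures.
From mathcomp Require Import all_boot all_order all_algebra.
From mathcomp Require Import all_classical all_reals all_analysis.
From mathcomp Require Import measurable_realfun ess_sup_inf complex.
From mathcomp Require Import ring lra.

(* Write w = v - u_oo. On time-independent fields the Fourier symbol of B tends,
   as t goes to infinity, to that of P div (u (x) v), so any constant eta that
   bounds B on C_w([0,oo), PM^2) also bounds this symbol pointwise. As
   v (x) v - u_oo (x) u_oo = w (x) v + u_oo (x) w, the Duhamel integrand for w is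
   at most 4 eps eta |w(tau)| + O(|G(tau) - F|) almost everywhere. If
   |w(t)| <= a for large t, cutting the time integral at a late time T makes the
   part before T decay like 1/(t - T), and the rest contributes at most
   4 eps eta a + o(1). Since 4 eps eta < 1, iterating this sends |w(t)| to 0. *)

Set Implicit Arguments.
Unset Strict Implicit.
Unset Printing Implicit Defensive.

Import Order.TTheory GRing.Theory Num.Theory.
Import numFieldNormedType.Exports.

Local Open Scope classical_set_scope.
Local Open Scope ring_scope.
Local Open Scope complex_scope.

Local Notation Re := complex.Re.
Local Notation Im := complex.Im.
Local Notation coord := Defs.coord.

(** * Complex triples and their integrals *)

(** The constant matters: the contraction is available only for the very [eta] of the hypothesis, so
    the product terms cannot be reestimated by hand with another constant. That hypothesis, however,
    bounds only time integrals of products. Testing it on fields frozen at a time tau recovers the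
    symbol itself, provided that the difference v(tau) - u_oo is exhibited as an element of [PM 2].
    Frozen-time bounds hold off a null set of frequencies that depends on tau, while Duhamel
    integrals are taken at fixed xi. Joint measurability in (tau, xi) and Tonelli exchange the two
    quantifiers, hence the measure theory on the space of frequencies. Integrals are total functions
    here, so the additivity of convolutions and of Duhamel integrals rests on integrability,
    established for almost every xi. Only the Leray bound on the force may be crude, since G(t) - F
    tends to 0. *)

Section ComplexTriples.
Variable R : realType.
Implicit Types z w : 'I_3 -> R[i].

(** The real inner product of C^3 seen as R^6; its norm is [cnorm]. *)
Definition cdot z w : R :=
  \sum_(j < 3) (Re (z j) * Re (w j) + Im (z j) * Im (w j)).

Lemma cdot_ge0 z : 0 <= cdot z z.
Proof. by apply: sumr_ge0 => j _; rewrite addr_ge0// -expr2 sqr_ge0. Qed.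

Lemma cnorm_cdot z : cnorm z = Num.sqrt (cdot z z).
Proof. by congr Num.sqrt; apply: eq_bigr => j _; rewrite !expr2. Qed.

Lemma cnorm_ge0 z : 0 <= cnorm z. Proof. exact: sqrtr_ge0. Qed.

Lemma sqr_cnorm z : cnorm z ^+ 2 = cdot z z.
Proof. by rewrite cnorm_cdot sqr_sqrtr// cdot_ge0. Qed.

Lemma cdot_le z w : cdot z w <= cnorm z * cnorm w.
Proof.
have key : cdot z w ^+ 2 <= cdot z z * cdot w w.
  have : 0 <= cdot z z * cdot w w - cdot z w ^+ 2; last by rewrite subr_ge0.
  rewrite /cdot !big_ord_recr !big_ord0 /= !add0r.
  set a := Re (z _); set b := Im (z _); set c := Re (z _); set d := Im (z _).
  set e := Re (z _); set f := Im (z _).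
  set a' := Re (w _); set b' := Im (w _); set c' := Re (w _); set d' := Im (w _).
  set e' := Re (w _); set f' := Im (w _).
  (* Lagrange's identity: the defect in Cauchy-Schwarz is the sum of the squares of the fifteen 2 x
     2 minors of two vectors of R^6. *)
  pose q x y x' y' := (x * y' - y * x') ^+ 2 : R.
  rewrite [leRHS](_ : _ = q a b a' b' + q a c a' c' + q a d a' d' + q a e a' e'
    + q a f a' f' + q b c b' c' + q b d b' d' + q b e b' e' + q b f b' f'
    + q c d c' d' + q c e c' e' + q c f c' f' + q d e d' e' + q d f d' f'
    + q e f e' f'); last by rewrite /q; ring.
  by rewrite !addr_ge0 ?sqr_ge0.
rewrite (le_trans (ler_norm _))// -ler_sqr ?nnegrE ?mulr_ge0 ?cnorm_ge0//.
by rewrite real_normK ?num_real// exprMn !sqr_cnorm.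
Qed.

Lemma cnormD z w : cnorm (fun j => z j + w j) <= cnorm z + cnorm w.
Proof.
rewrite -ler_sqr ?nnegrE ?addr_ge0 ?cnorm_ge0// sqr_cnorm sqrrD !sqr_cnorm.
rewrite (_ : cdot _ _ = cdot z z + cdot z w *+ 2 + cdot w w).
  by rewrite lerD2r lerD2l lerMn2r cdot_le orbT.
rewrite /cdot !big_ord_recr !big_ord0 /= !add0r.
by rewrite !raddfD/=; ring.
Qed.

Lemma cnormZ (a : R) z : cnorm (fun j => a%:C * z j) = `|a| * cnorm z.
Proof.
rewrite /cnorm -sqrtr_sqr -sqrtrM ?sqr_ge0//; congr Num.sqrt.
rewrite mulr_sumr; apply: eq_bigr => j _; case: (z j) => x y /=; ring.
Qed.

Lemma cnormN z : cnorm (fun j => - z j) = cnorm z.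
Proof.
by congr Num.sqrt; apply: eq_bigr => j _; rewrite !raddfN /= !sqrrN.
Qed.

Lemma cnormB z w : cnorm (fun j => z j - w j) <= cnorm z + cnorm w.
Proof. by rewrite -(cnormN w); exact: cnormD. Qed.

Lemma cnorm_le_sum z :
  cnorm z <= \sum_(j < 3) (`|Re (z j)| + `|Im (z j)|).
Proof.
rewrite -ler_sqr ?nnegrE ?cnorm_ge0//; last first.
  by apply: sumr_ge0 => j _; rewrite addr_ge0.
have sq (x y : R) : 0 <= x -> 0 <= y -> x ^+ 2 + y ^+ 2 <= (x + y) ^+ 2.
  by move=> x0 y0; rewrite sqrrD lerD2r lerDl mulrn_wge0// mulr_ge0.
have sq' (x y : R) : x * x + y * y <= (`|x| + `|y|) ^+ 2.
  by rewrite -!expr2 -(@real_normK _ x) ?num_real// -(@real_normK _ y) ?num_real// sq.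
rewrite sqr_cnorm /cdot !big_ord_recr !big_ord0 /= !add0r.
rewrite (le_trans (lerD (lerD (sq' _ _) (sq' _ _)) (sq' _ _)))//.
by rewrite (le_trans _ (sq _ _ _ _)) ?lerD2r ?sq ?addr_ge0.
Qed.

Lemma Re_le_cnorm z j : `|Re (z j)| <= cnorm z.
Proof.
rewrite -sqrtr_sqr ler_sqrt ?sumr_ge0// => [|i _]; last first.
  by rewrite addr_ge0 ?sqr_ge0.
rewrite (bigD1 j)//= -addrA lerDl addr_ge0 ?sqr_ge0 ?sumr_ge0// => i _.
by rewrite addr_ge0 ?sqr_ge0.
Qed.

Lemma Im_le_cnorm z j : `|Im (z j)| <= cnorm z.
Proof.
rewrite -sqrtr_sqr ler_sqrt ?sumr_ge0// => [|i _]; last first.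
  by rewrite addr_ge0 ?sqr_ge0.
rewrite (bigD1 j)//= addrAC lerDr addr_ge0 ?sqr_ge0 ?sumr_ge0// => i _.
by rewrite addr_ge0 ?sqr_ge0.
Qed.

End ComplexTriples.

(** * Complex-valued integrals and domination almost everywhere *)

Section ComplexIntegral.
Context d (T : measurableType d) (R : realType).
Variables (mu : {measure set T -> \bar R}) (D : set T).
Hypothesis mD : measurable D.
Implicit Types f g : T -> R[i].

Definition cintegrable f := mu.-integrable D (EFin \o (fun x => Re (f x))) /\
  mu.-integrable D (EFin \o (fun x => Im (f x))).

Lemma eq_cintegral f g : (forall x, D x -> f x = g x) ->
  cintegral mu D f = cintegral mu D g.
Proof.
by move=> fg; congr (_ +i* _); apply: eq_Rintegral => x;
  rewrite inE => /fg ->.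
Qed.

Lemma integrableDR (f g : T -> R) : mu.-integrable D (EFin \o f) ->
  mu.-integrable D (EFin \o g) -> mu.-integrable D (EFin \o (fun x => f x + g x)).
Proof. by move=> fi gi; exact: (integrableD mD fi gi). Qed.

Lemma integrableZR (a : R) (f : T -> R) : mu.-integrable D (EFin \o f) ->
  mu.-integrable D (EFin \o (fun x => a * f x)).
Proof. by move=> fi; exact: (integrableZl mD a fi). Qed.

Lemma cintegrableD f g : cintegrable f -> cintegrable g ->
  cintegrable (fun x => f x + g x).
Proof.
move=> [f1 f2] [g1 g2]; split.
  by under [EFin \o _]eq_fun do rewrite /= raddfD/=; exact: integrableDR.
by under [EFin \o _]eq_fun do rewrite /= raddfD/=; exact: integrableDR.
Qed.

Lemma cintegralD f g : cintegrable f -> cintegrable g ->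
  cintegral mu D (fun x => f x + g x) = cintegral mu D f + cintegral mu D g.
Proof.
move=> [f1 f2] [g1 g2]; rewrite /cintegral.
under [X in X +i* _]eq_Rintegral do rewrite raddfD/=.
under [X in _ +i* X]eq_Rintegral do rewrite raddfD/=.
by rewrite !RintegralD.
Qed.

Lemma cintegrableZ (c : R[i]) f : cintegrable f -> cintegrable (fun x => c * f x).
Proof.
case: c => a b [f1 f2]; split.
  under [EFin \o _]eq_fun => x /=.
    rewrite (_ : Re _ = a * Re (f x) + (- b) * Im (f x)); last first.
      by case: (f x) => u w /=; ring.
    over.
  by apply: integrableDR; exact: integrableZR.
under [EFin \o _]eq_fun => x /=.
  rewrite (_ : Im _ = a * Im (f x) + b * Re (f x)); last first.
    by case: (f x) => u w /=; ring.
  over.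
by apply: integrableDR; exact: integrableZR.
Qed.

Lemma cintegralZ (c : R[i]) f : cintegrable f ->
  cintegral mu D (fun x => c * f x) = c * cintegral mu D f.
Proof.
case: c => a b [f1 f2]; rewrite /cintegral.
under [X in X +i* _]eq_Rintegral => x _.
  rewrite (_ : Re _ = a * Re (f x) + (- b) * Im (f x)); last first.
    by case: (f x) => u w /=; ring.
  over.
under [X in _ +i* X]eq_Rintegral => x _.
  rewrite (_ : Im _ = a * Im (f x) + b * Re (f x)); last first.
    by case: (f x) => u w /=; ring.
  over.
rewrite !RintegralD ?RintegralZl//=; try exact: integrableZR.
by apply/eqP; rewrite eq_complex/=; apply/andP; split; apply/eqP; ring.
Qed.

Lemma cintegrableN f : cintegrable f -> cintegrable (fun x => - f x).
Proof.
by move=> fi; under eq_fun do rewrite -mulN1r; exact: cintegrableZ.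
Qed.

Lemma cintegralN f : cintegrable f ->
  cintegral mu D (fun x => - f x) = - cintegral mu D f.
Proof.
move=> fi; rewrite -mulN1r -cintegralZ//.
by apply: eq_cintegral => x _; rewrite mulN1r.
Qed.

Lemma cintegrableB f g : cintegrable f -> cintegrable g ->
  cintegrable (fun x => f x - g x).
Proof. by move=> fi gi; apply: cintegrableD => //; exact: cintegrableN. Qed.

Lemma cintegralB f g : cintegrable f -> cintegrable g ->
  cintegral mu D (fun x => f x - g x) = cintegral mu D f - cintegral mu D g.
Proof.
by move=> fi gi; rewrite cintegralD ?cintegralN//; exact: cintegrableN.
Qed.

Lemma ae_le_integrable (f b : T -> R) : measurable_fun D f ->
  mu.-integrable D (EFin \o b) -> {ae mu, forall x, D x -> `|f x| <= b x} ->
  mu.-integrable D (EFin \o f).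
Proof.
move=> mf bi fb; have mEf : measurable_fun D (fun x => (f x)%:E).
  exact/measurable_EFinP.
apply/integrableP; split=> //.
apply: (@le_lt_trans _ _ (\int[mu]_(x in D) `|(b x)%:E|)%E); last first.
  by case/integrableP : bi.
apply: ae_ge0_le_integral => //.
- exact: measurableT_comp.
- by apply: measurableT_comp => //; case/integrableP : bi.
- by apply: filterS fb => x fb /fb /= le; rewrite lee_fin (le_trans le)// ler_norm.
Qed.

Lemma ae_le_Rintegral (f g : T -> R) : mu.-integrable D (EFin \o f) ->
  mu.-integrable D (EFin \o g) -> {ae mu, forall x, D x -> f x <= g x} ->
  Rintegral mu D f <= Rintegral mu D g.
Proof.
move=> fi gi fg.
(* The maximum dominates f everywhere and equals g almost everywhere, which reduces the claim to
   monotonicity under a pointwise inequality. *)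
have h : mu.-integrable D (EFin \o (fun x => Num.max (f x) (g x))).
  apply: (@ae_le_integrable _ (fun x => `|f x| + `|g x|)).
  - case/integrableP : fi gi => /measurable_EFinP mf _ /integrableP[/measurable_EFinP mg _].
    exact: measurable_maxr.
  - by apply: integrableDR; exact: integrable_norm.
  - apply: aeW => x _; have [//|_] := leP (f x) (g x).
      by rewrite ler_wpDl.
    by rewrite ler_wpDr.
apply: (@le_trans _ _ (Rintegral mu D (fun x => Num.max (f x) (g x)))).
  by apply: le_Rintegral => // x _; rewrite le_max lexx.
rewrite [leLHS](_ : _ = Rintegral mu D g)//; congr fine.
apply: ae_eq_integral => //; [by case/integrableP : h|by case/integrableP : gi|].
by apply: filterS fg => x fg Dx /=; rewrite max_r// fg.
Qed.

(** Duality: with I the integral, |I|^2 is the integral of [cdot I (f x)], hence at most |I| times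
    the integral of b. This keeps the constant 1, which a componentwise estimate would lose. *)
Lemma cnorm_cintegral_le (f : T -> 'I_3 -> R[i]) (b : T -> R) :
  (forall j, cintegrable (f ^~ j)) -> mu.-integrable D (EFin \o b) ->
  {ae mu, forall x, D x -> cnorm (f x) <= b x} ->
  cnorm (fun j => cintegral mu D (f ^~ j)) <= Rintegral mu D b.
Proof.
move=> fi bi fb; set J := fun j => _.
have [I IE] : exists I : 'I_3 -> R[i], I = J by exists J.
rewrite -IE.
have b0 : 0 <= Rintegral mu D b.
  rewrite -[leLHS](_ : Rintegral mu D (fun=> 0) = 0); last first.
    by rewrite /Rintegral integral0.
  apply: ae_le_Rintegral => //; first exact: integrable0.
  by apply: filterS fb => x fb /fb; apply: le_trans; exact: cnorm_ge0.
have [I0|I0] := eqVneq (cnorm I) 0; first by rewrite I0.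
have Ip : 0 < cnorm I by rewrite lt_neqAle eq_sym I0 cnorm_ge0.
rewrite -(ler_pM2l Ip) -expr2 sqr_cnorm.
have fij j : mu.-integrable D (EFin \o
    (fun x => Re (I j) * Re (f x j) + Im (I j) * Im (f x j))).
  have [f1 f2] := fi j.
  exact: integrableDR (integrableZR _ f1) (integrableZR _ f2).
have -> : cdot I I = Rintegral mu D (fun x => cdot I (f x)).
  rewrite /cdot; under eq_Rintegral do rewrite !big_ord_recr big_ord0 /= add0r.
  rewrite RintegralD//; last exact: integrableDR (fij _) (fij _).
  rewrite RintegralD// !big_ord_recr big_ord0 /= add0r.
  have fijE j : Rintegral mu D (fun x => Re (I j) * Re (f x j) + Im (I j) * Im (f x j))
      = Re (I j) * Re (J j) + Im (I j) * Im (J j).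
    have [f1 f2] := fi j.
    rewrite (RintegralD mD (integrableZR _ f1) (integrableZR _ f2)).
    by rewrite (RintegralZl _ mD f1) (RintegralZl _ mD f2).
  by rewrite !fijE -IE.
rewrite -RintegralZl//; apply: ae_le_Rintegral.
- rewrite /cdot; under [EFin \o _]eq_fun do rewrite /= !big_ord_recr big_ord0 /= add0r.
  exact: integrableDR (integrableDR (fij _) (fij _)) (fij _).
- exact: integrableZR.
- apply: filterS fb => x fb Dx; rewrite (le_trans (cdot_le _ _))//.
  by rewrite ler_wpM2l ?fb ?cnorm_ge0.
Qed.

End ComplexIntegral.

Section ComplexMeasurable.
Context d (T : measurableType d) (R : realType).
Implicit Types f g : T -> R[i].

Definition cmeasurable f := measurable_fun setT (fun x => Re (f x)) /\
  measurable_fun setT (fun x => Im (f x)).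

Lemma cmeasurable_cst (c : R[i]) : cmeasurable (fun=> c).
Proof. by split. Qed.

Lemma cmeasurable_real (f : T -> R) :
  measurable_fun setT f -> cmeasurable (fun x => (f x)%:C).
Proof. by move=> mf; split. Qed.

Lemma cmeasurableD f g :
  cmeasurable f -> cmeasurable g -> cmeasurable (fun x => f x + g x).
Proof.
move=> [f1 f2] [g1 g2]; split; under eq_fun do rewrite raddfD/=;
  exact: measurable_funD.
Qed.

Lemma cmeasurableM f g :
  cmeasurable f -> cmeasurable g -> cmeasurable (fun x => f x * g x).
Proof.
move=> [f1 f2] [g1 g2]; split.
  rewrite (_ : (fun x => _) = fun x => Re (f x) * Re (g x) - Im (f x) * Im (g x)).
    by apply: measurable_funB; exact: measurable_funM.
  by apply/funext => x; case: (f x) (g x) => ? ? [].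
rewrite (_ : (fun x => _) = fun x => Re (f x) * Im (g x) + Im (f x) * Re (g x)).
  by apply: measurable_funD; exact: measurable_funM.
by apply/funext => x; case: (f x) (g x) => ? ? [].
Qed.

Lemma cmeasurableN f : cmeasurable f -> cmeasurable (fun x => - f x).
Proof.
move=> mf; under eq_fun do rewrite -mulN1r.
exact: cmeasurableM (cmeasurable_cst _) mf.
Qed.

Lemma cmeasurableB f g :
  cmeasurable f -> cmeasurable g -> cmeasurable (fun x => f x - g x).
Proof. by move=> mf mg; apply: cmeasurableD => //; exact: cmeasurableN. Qed.

Lemma cmeasurable_sum3 (F : 'I_3 -> T -> R[i]) :
  (forall k, cmeasurable (F k)) -> cmeasurable (fun x => \sum_(k < 3) F k x).
Proof.
move=> mF; under eq_fun do rewrite !big_ord_recr big_ord0 /= add0r.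
by apply: cmeasurableD => //; exact: cmeasurableD.
Qed.

Lemma measurable_cnorm (F : T -> 'I_3 -> R[i]) :
  (forall k, cmeasurable (F ^~ k)) -> measurable_fun setT (fun x => cnorm (F x)).
Proof.
move=> mF; rewrite /cnorm.
have ms : measurable_fun [set: R] (@Num.sqrt R).
  by apply: continuous_measurable_fun; exact: sqrt_continuous.
apply: (measurableT_comp ms); under eq_fun do rewrite !big_ord_recr big_ord0 /= add0r.
have mk k : measurable_fun setT (fun x => Re (F x k) ^+ 2 + Im (F x k) ^+ 2).
  by have [? ?] := mF k; apply: measurable_funD; exact: measurable_funX.
by apply: measurable_funD => //; exact: measurable_funD.
Qed.

Lemma cmeasurable_comp d' (T' : measurableType d') (h : T' -> T) f :
  measurable_fun setT h -> cmeasurable f ->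
  measurable_fun setT (fun x => Re (f (h x))) /\
  measurable_fun setT (fun x => Im (f (h x))).
Proof.
by move=> mh [f1 f2]; split;
  [exact: (measurableT_comp f1 mh)|exact: (measurableT_comp f2 mh)].
Qed.

End ComplexMeasurable.

(** * Lebesgue measure on the space of frequencies *)

Definition image_measure d d' (T : measurableType d) (T' : measurableType d')
    (R : realType) (m : {measure set T -> \bar R}) (f : T -> T')
    (mf : measurable_fun setT f) : {measure set T' -> \bar R} :=
  measure_function_pushforward__canonical__measure_function_Measure m mf.

(** * Product measures: null sets, parametric integrals, invariance *)

Section ProductMeasure.
Context d1 d2 (T1 : measurableType d1) (T2 : measurableType d2) (R : realType).
Variables (m1 : {sigma_finite_measure set T1 -> \bar R}).
Variables (m2 : {sigma_finite_measure set T2 -> \bar R}).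

(** Tonelli for null sets: integrating the measures of the sections of A in either order gives the
    same product measure, here zero. *)
Lemma ae_ae_swap (A : set (T1 * T2)) : measurable A ->
  {ae m1, forall x, {ae m2, forall y, ~ A (x, y)}} ->
  {ae m2, forall y, {ae m1, forall x, ~ A (x, y)}}.
Proof.
move=> mA A0.
have m2A0 : (m1 \x^ m2)%E A = 0%E.
  rewrite -(@product_measure_unique _ _ _ _ _ m1 m2 (m1 \x^ m2)%E)//; last first.
    by move=> B C mB mC; exact: product_measure2E.
  rewrite /product_measure1 (@ae_eq_integral _ _ _ _ _ (cst 0%E))//.
  - by rewrite integral0.
  - exact: measurable_fun_xsection.
  apply: filterS A0 => x [N [mN N0 AN]] _ /=.
  apply/eqP; rewrite -measure_le0 -N0 le_measure ?inE//.
    exact: measurable_xsection.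
  by move=> y /xsectionP Axy; apply: AN => /=; apply.
have mys : measurable_fun setT (m1 \o ysection A) by exact: measurable_fun_ysection.
have := m2A0; rewrite /product_measure2.
under eq_integral => y _ do rewrite -[(m1 \o _) y]gee0_abs ?measure_ge0//.
move/(ae_eq_integral_abs m2 measurableT mys); apply: filterS => y /(_ I) /= Ay0.
exists (ysection A y); split=> //; first exact: measurable_ysection.
by move=> x /= /contrapT Axy; apply/ysectionP.
Qed.

(** The positive and negative parts are integrated separately, each depending measurably on x by
    Tonelli, and [fine] is measurable; divergent integrals are thus covered. *)
Lemma measurable_Rintegral (f : T1 * T2 -> R) : measurable_fun setT f ->
  measurable_fun setT (fun x => Rintegral m2 setT (fun y => f (x, y))).
Proof.
move=> mf; rewrite /Rintegral.
under eq_fun do rewrite integralE.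
apply: measurableT_comp => //.
have mEf : measurable_fun setT (EFin \o f) by exact/measurable_EFinP.
apply: emeasurable_funB.
- rewrite [X in measurable_fun _ X](_ : _ = fubini_F m2 (EFin \o f)^\+%E).
    apply: measurable_fun_fubini_tonelli_F; first exact: measurable_funepos.
    exact: funepos_ge0.
  by apply/funext => x; apply: eq_integral => y _; rewrite !funeposE.
- rewrite [X in measurable_fun _ X](_ : _ = fubini_F m2 (EFin \o f)^\-%E).
    apply: measurable_fun_fubini_tonelli_F; first exact: measurable_funeneg.
    exact: funeneg_ge0.
  by apply/funext => x; apply: eq_integral => y _; rewrite !funenegE.
Qed.

Lemma cmeasurable_cintegral (f : T1 * T2 -> R[i]) : cmeasurable f ->
  cmeasurable (fun x => cintegral m2 setT (fun y => f (x, y))).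
Proof.
by move=> [f1 f2]; split;
  [exact: (measurable_Rintegral f1)|exact: (measurable_Rintegral f2)].
Qed.

(** The push-forward of the product measure agrees with it on rectangles, which determine it. *)
Lemma product_measure_preserving (f1 : T1 -> T1) (f2 : T2 -> T2) :
  measurable_fun setT f1 -> measurable_fun setT f2 ->
  (forall A, measurable A -> m1 (f1 @^-1` A) = m1 A) ->
  (forall A, measurable A -> m2 (f2 @^-1` A) = m2 A) ->
  forall X, measurable X ->
  (m1 \x m2)%E ((fun x => (f1 x.1, f2 x.2)) @^-1` X) = (m1 \x m2)%E X.
Proof.
move=> mf1 mf2 f1E f2E X mX; apply/esym.
have mf : measurable_fun setT (fun x : T1 * T2 => (f1 x.1, f2 x.2)).
  apply/measurable_fun_pairP; split.
    exact: (measurableT_comp mf1 measurable_fst).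
  exact: (measurableT_comp mf2 measurable_snd).
apply: (product_measure_unique (m' := image_measure (m1 \x m2)%E mf)) => // A B mA mB.
rewrite -(f1E _ mA) -(f2E _ mB) -product_measure1E//.
- by rewrite -[_ @^-1` _]setTI; exact: mf1.
- by rewrite -[_ @^-1` _]setTI; exact: mf2.
Qed.

Lemma product_measure_sigma_finite : sigma_finite setT (m1 \x m2)%E.
Proof.
have /sigma_finiteP[F [TF ndF Foo]] := sigma_finiteT m1.
have /sigma_finiteP[G [TG ndG Goo]] := sigma_finiteT m2.
exists (fun n => F n `*` G n).
  apply/esym; rewrite -subTset => -[x y] _.
  have : setT x by []. rewrite TF => -[n _ Fnx].
  have : setT y by []. rewrite TG => -[k _ Gky].
  exists (maxn n k) => //; split.
  - by move: x Fnx; exact/subsetPset/ndF/leq_maxl.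
  - by move: y Gky; exact/subsetPset/ndG/leq_maxr.
move=> k; have [mF Fk] := Foo k; have [mG Gk] := Goo k.
split; first exact: measurableX.
by rewrite product_measure1E// lte_mul_pinfty// ge0_fin_numE.
Qed.

(* The library's sigma-finite structure on a product measure is shadowed by its
   instance for subprobabilities, hence this explicit packing. *)
Definition product_sfinite : {sigma_finite_measure set (T1 * T2)%type -> \bar R} :=
  HB.pack (m1 \x m2)%E
    (Measure_isSigmaFinite.Build _ _ _ (m1 \x m2)%E product_measure_sigma_finite).

End ProductMeasure.

#[export] Instance mu3_ae_filter (R : realType) :
  Filter (nbhs (almost_everywhere (mu3 R))).
Proof.
exact: (@ae_filter_ringOfSetsType _
  (measurableTypeR R * measurableTypeR R * measurableTypeR R)%type R (mu3 R)).
Qed.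

#[export] Instance lebesgue_ae_filter (R : realType) :
  Filter (nbhs (almost_everywhere (@lebesgue_measure R))).
Proof. exact: (@ae_filter_ringOfSetsType _ (measurableTypeR R) R). Qed.

Section EuclideanSpace.
Variable R : realType.
Local Notation space := (Defs.space R).
Local Notation leb := (@lebesgue_measure R).
(* [R] itself carries a measurable structure with another display than that of
   the domain of the Lebesgue measure. *)
Local Notation mR := (measurableTypeR R).
Local Notation mspace := (mR * mR * mR)%type.

(** [vol2] and [vol] are the product measures underlying [mu3], repackaged with the sigma-finiteness
    that Tonelli requires. *)
Definition vol2 := product_sfinite leb leb.
Definition vol := product_sfinite vol2 leb.

Lemma ord3P (P : 'I_3 -> Prop) : P 0 -> P 1 -> P ord_max -> forall j, P j.
Proof.
move=> P0 P1 P2 [[|[|[|//]]] jn].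
- by rewrite (_ : Ordinal _ = 0)//; exact/val_inj.
- by rewrite (_ : Ordinal _ = 1)//; exact/val_inj.
- by rewrite (_ : Ordinal _ = ord_max)//; exact/val_inj.
Qed.

Lemma coordB (x y : space) j : coord (x - y) j = coord x j - coord y j.
Proof. by elim/ord3P: j. Qed.

Lemma enorm_cnorm (x : space) : enorm x = cnorm (fun j => (coord x j)%:C).
Proof.
by congr Num.sqrt; apply: eq_bigr => j _; rewrite /= expr0n addr0 expr2.
Qed.

Lemma enorm_ge0 (x : space) : 0 <= enorm x. Proof. exact: sqrtr_ge0. Qed.

Lemma coord_le_enorm (x : space) j : `|coord x j| <= enorm x.
Proof. by rewrite enorm_cnorm (le_trans _ (Re_le_cnorm _ j)). Qed.

Lemma enorm_le_sum (x : space) : enorm x <= `|x.1.1| + `|x.1.2| + `|x.2|.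
Proof.
rewrite enorm_cnorm (le_trans (cnorm_le_sum _))//=.
by rewrite !big_ord_recr big_ord0 /= normr0 !addr0 add0r.
Qed.

Lemma enorm_sub_le (x y : space) : enorm x <= enorm (x - y) + enorm y.
Proof.
rewrite !enorm_cnorm (le_trans _ (cnormD _ _))//.
rewrite le_eqVlt; apply/orP; left; apply/eqP; congr cnorm.
by apply/funext => j; rewrite coordB -rmorphD/= subrK.
Qed.

Lemma enorm_gt0 (x : space) : x != 0 -> 0 < enorm x.
Proof.
move=> x0; rewrite lt_neqAle enorm_ge0 andbT eq_sym; apply: contra_neq x0 => x0.
case: x x0 => -[a b] c x0.
have h j : coord (a, b, c) j = 0.
  by apply/eqP; rewrite -normr_le0 (le_trans (coord_le_enorm _ _))// x0.
have [-> -> ->] // : [/\ a = 0, b = 0 & c = 0].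
by split; [exact: (h 0)|exact: (h 1)|exact: (h ord_max)].
Qed.

Lemma measurable_coord j : measurable_fun [set: mspace] (fun x : mspace => coord x j).
Proof.
elim/ord3P: j.
- by apply: (measurableT_comp measurable_fst); exact: measurable_fst.
- by apply: (measurableT_comp measurable_snd); exact: measurable_fst.
- exact: measurable_snd.
Qed.

Lemma measurable_enorm : measurable_fun [set: mspace] (@enorm R).
Proof.
apply: measurableT_comp.
  by apply: continuous_measurable_fun; exact: sqrt_continuous.
rewrite /dot; under eq_fun do rewrite !big_ord_recr big_ord0/=.
by repeat (apply: measurable_funD || apply: measurable_funM);
  (exact: measurable_cst || exact: measurable_coord).
Qed.

Lemma lebesgue_measure_reflect (a : R) (A : set R) :
  measurable (A : set (measurableTypeR R)) ->
  leb ((fun x => a - x) @^-1` A) = leb A.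
Proof.
have mr : measurable_fun setT (fun x : measurableTypeR R => a - x : measurableTypeR R).
  by apply: measurable_funB.
pose m := image_measure leb mr.
move=> mA; apply/esym; rewrite -[RHS]/(m A).
apply: (lebesgue_measure_unique _ mA) => X /ocitvP[->|[[b c] /= bc ->]].
  by rewrite !measure0.
rewrite [RHS]/= /pushforward/=.
(* The reflection exchanges which endpoint belongs to the interval; the length is unaffected. *)
rewrite (_ : _ @^-1` _ = `[a - c, a - b[%classic); last first.
  by apply/seteqP; split=> x /=; rewrite !in_itv/=; lra.
by rewrite !lebesgue_measure_itv/= !lte_fin bc ltrD2l ltrN2 bc -!EFinD; congr EFin; ring.
Qed.

Lemma measurable_reflect (a : space) :
  measurable_fun [set: mspace] (fun x : mspace => (a - x : space) : mspace).
Proof.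
by apply/measurable_fun_pairP; split; [apply/measurable_fun_pairP; split|];
  apply: measurable_funB => //; exact: (measurable_coord 0) ||
    exact: (measurable_coord 1) || exact: (measurable_coord ord_max).
Qed.

(** Justifies the change of variables y -> xi - y in convolutions. *)
Lemma mu3_reflect (a : space) (A : set mspace) : measurable A ->
  mu3 R ((fun x : space => a - x) @^-1` A) = mu3 R A.
Proof.
have mr (b : R) : measurable_fun setT (fun x : measurableTypeR R => b - x : measurableTypeR R).
  by apply: measurable_funB.
apply: (product_measure_preserving (m1 := vol2) (m2 := leb)
  (f1 := fun x => (a.1.1 - x.1, a.1.2 - x.2)) (f2 := fun x => a.2 - x)) => //.
- apply/measurable_fun_pairP; split.
    exact: (measurableT_comp (mr _) measurable_fst).
  exact: (measurableT_comp (mr _) measurable_snd).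
- apply: (product_measure_preserving (m1 := leb) (m2 := leb)
    (f1 := fun x => a.1.1 - x) (f2 := fun x => a.1.2 - x)) => //;
    exact: lebesgue_measure_reflect.
- exact: lebesgue_measure_reflect.
Qed.
End EuclideanSpace.

(** * Reflections, cubes and integrable decay *)

Section MeasureOnSpace.
Variable R : realType.
Local Notation space := (Defs.space R).
Local Notation leb := (@lebesgue_measure R).
Local Notation mR := (measurableTypeR R).
Local Notation mspace := (mR * mR * mR)%type.
Local Notation mu := (mu3 R).

Lemma ae_reflect (a : space) (P : space -> Prop) :
  {ae mu, forall x, P x} -> {ae mu, forall x, P (a - x)}.
Proof.
move=> [N [mN N0 PN]]; exists ((fun x : space => a - x) @^-1` N); split.
- by rewrite -[_ @^-1` _]setTI; exact: measurable_reflect.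
- by rewrite mu3_reflect.
- by move=> x /= nP; apply: PN.
Qed.

Lemma integrable_reflect (a : space) (f : space -> R) :
  mu.-integrable setT (EFin \o f) ->
  mu.-integrable setT (EFin \o (fun x => f (a - x))).
Proof.
move=> /integrableP[mf foo]; apply/integrableP; split.
  exact: (measurableT_comp mf (measurable_reflect a)).
move: foo; rewrite (@eq_measure_integral _ _ _ setT (image_measure mu (measurable_reflect a))).
  rewrite ge0_integral_pushforward//; first exact: measurable_reflect.
  exact: measurableT_comp.
by move=> A mA _; rewrite -(mu3_reflect a).
Qed.

(** Cubes stand in for Euclidean balls: being compact they fall under local integrability, and being
    rectangles they have a volume given by a product. *)
Definition box (r : R) : set space := (`[- r, r] `*` `[- r, r]) `*` `[- r, r].

Lemma in_box r (x : space) : (forall j, `|coord x j| <= r) -> box r x.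
Proof.
move=> xr; have := xr 0; have := xr 1; have := xr ord_max.
by rewrite !ler_norml => x3 x2 x1; split => /=; [split|]; rewrite in_itv.
Qed.

Lemma notin_box r (x : space) : ~ box r x -> r < enorm x.
Proof.
apply: contra_notP => /negP; rewrite -leNgt => xr; apply: in_box => j.
exact: le_trans (coord_le_enorm _ _) xr.
Qed.

Lemma compact_box r : compact (box r).
Proof. by repeat apply: compact_setX; exact: segment_compact. Qed.

Lemma measurable_box r : measurable (box r : set mspace).
Proof.
have mI : measurable (`[- r, r]%classic : set mR) by exact: measurable_itv.
exact: measurableX (measurableX mI mI) mI.
Qed.

Lemma mu3_box (r : R) : 0 <= r -> mu (box r) = ((2 * r) ^+ 3)%:E.
Proof.
move=> r0.
have lr : leb `[- r, r] = (2 * r)%:E.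
  rewrite lebesgue_measure_itv/= lte_fin; case: ifPn => [_|].
    by rewrite -EFinD; congr EFin; ring.
  rewrite -leNgt => rN; have r00 : r = 0 by lra.
  by rewrite r00 mulr0.
have mI : measurable (`[- r, r]%classic : set mR) by exact: measurable_itv.
have -> : mu (box r) = ((2 * r)%:E * (2 * r)%:E * (2 * r)%:E)%E.
  apply: etrans (product_measure1E (vol2 R) leb (measurableX mI mI) mI) _.
  congr (_ * _)%E; last exact: lr.
  by apply: etrans (product_measure1E leb leb mI mI) _; congr (_ * _)%E.
rewrite -!EFinM.
by congr EFin; rewrite !exprS expr0 mulr1 mulrA.
Qed.

Lemma bigcup_box : \bigcup_n box n%:R = [set: space].
Proof.
rewrite -subTset => x _; exists (Num.bound (enorm x)) => //; apply: in_box => j.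
by rewrite (le_trans (coord_le_enorm _ _))// ltW// archi_boundP// enorm_ge0.
Qed.

(* Compare with the sum over n of 16^-n on the cube of half-side 2^n, whose
   volume is of order 8^n. *)
Lemma integrable_decay :
  mu.-integrable setT (EFin \o (fun x : space => (1 + enorm x) ^- 4)).
Proof.
have md : measurable_fun [set: mspace] (fun x : mspace => (1 + enorm x) ^- 4).
  (* The absolute value keeps the denominator nonzero on all of R, so that measurability follows
     from continuity. *)
  have cf : continuous (fun y : R => (1 + `|y|) ^- 4).
    move=> y; apply: (@continuousV R _ (fun y : R => (1 + `|y|) ^+ 4)).
      by rewrite expf_eq0/= gt_eqF// ltr_pwDl.
    apply: (@continuous_comp _ _ _ (fun y : R => 1 + `|y|) (fun y : R => y ^+ 4)).
      by apply: continuousD; [exact: cvg_cst|exact: norm_continuous].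
    exact: exprn_continuous.
  have := measurableT_comp (continuous_measurable_fun cf) (@measurable_enorm R).
  by apply: eq_measurable_fun => x _ /=; rewrite ger0_norm// enorm_ge0.
pose c n : \bar R := (16 ^- n)%:E.
pose S (x : space) := (\sum_(n <oo) (c n * (\1_(box (2 ^+ n)) x)%:E))%E.
have mcn n : measurable_fun [set: mspace] (fun x : mspace => (c n * (\1_(box (2 ^+ n)) x)%:E)%E).
  apply: measurable_funeM; apply/measurable_EFinP.
  by apply: measurable_indic; exact: measurable_box.
have cn0 n (x : space) : (0 <= c n * (\1_(box (2 ^+ n)) x)%:E)%E.
  by rewrite mule_ge0// lee_fin ?invr_ge0 ?exprn_ge0.
have S0 x : (0 <= S x)%E by apply: nneseries_ge0.
have Sge n x : box (2 ^+ n) x -> (c n <= S x)%E.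
  move=> xn; rewrite -[leLHS]mule1.
  have := @nneseries_lim_ge R (fun n => c n * (\1_(box (2 ^+ n)) x)%:E)%E xpredT 0 n.+1.
  move=> /(_ (fun n _ _ => cn0 n x)); apply: le_trans.
  rewrite big_nat_recr//= indicE mem_set// leeDr//.
  by apply: sume_ge0 => i _.
(* The value 16^-n (2 * 2^n)^3 = 8 * 2^-n, written in the shape of the geometric series summed
   below. *)
have Sn n : (\int[mu]_x (c n * (\1_(box (2 ^+ n)) x)%:E) = (16 / (2 ^ (n + 1))%:R)%:E)%E.
  rewrite ge0_integralZl//.
  - rewrite integral_indic ?setIT//; last exact: measurable_box.
    rewrite mu3_box ?exprn_ge0// -EFinM; congr EFin.
    rewrite natrX exprD expr1 (_ : 16 = 2 ^+ 4); last by rewrite -natrX.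
    rewrite exprAC; have : 2 ^+ n != 0 :> R by rewrite expf_eq0/= pnatr_eq0 andbF.
    by move: (2 ^+ n) => y y0; field.
  - by apply/measurable_EFinP; apply: measurable_indic; exact: measurable_box.
  - by rewrite lee_fin invr_ge0 exprn_ge0.
have Soo : (\int[mu]_x S x < +oo)%E.
  rewrite integral_nneseries//; under eq_eseriesr do rewrite Sn.
  rewrite (cvg_lim _ (@cvg_geometric_eseries_half _ 16 0))//.
  exact: ltry.
apply/integrableP; split; first exact/measurable_EFinP.
apply: (@le_lt_trans _ _ (\int[mu]_x (16%:E * S x)))%E; last first.
  rewrite ge0_integralZl//; last exact: ge0_emeasurable_sum.
  by rewrite lte_mul_pinfty.
apply: ge0_le_integral => //.
- by apply: measurableT_comp => //; exact/measurable_EFinP.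
- by apply: measurable_funeM; exact: ge0_emeasurable_sum.
move=> x _; rewrite gee0_abs ?lee_fin ?invr_ge0 ?exprn_ge0 ?addr_ge0 ?enorm_ge0//=.
(* The smallest dyadic cube containing x. If it has index n + 1, then 2^n < |x| by minimality, so
   the decay is at most 16^-n; this shift of index is the origin of the factor 16. *)
have [n nP nmin] : exists2 n, `[< box (2 ^+ n) x >] &
    forall m, `[< box (2 ^+ m) x >] -> (n <= m)%N.
  have ex : exists n, `[< box (2 ^+ n) x >].
    exists (Num.bound (enorm x)); apply/asboolP; apply: in_box => j.
    rewrite (le_trans (coord_le_enorm _ _))// ltW//.
    rewrite (lt_trans (archi_boundP _)) ?enorm_ge0//.
    by rewrite -natrX ltr_nat ltn_expl.
  by case: (ex_minnP ex) => n; exists n.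
apply: (@le_trans _ _ (16%:E * c n)%E); last first.
  by rewrite lee_pmul2l//; apply: Sge; exact/asboolP.
rewrite /c -EFinM lee_fin; case: n nP nmin => [_ _|n nP nmin].
  rewrite expr0 invr1 mulr1 (@le_trans _ _ 1)// ?ler1n// invf_le1 ?exprn_gt0//.
    by rewrite exprn_ege1// lerDl enorm_ge0.
  by rewrite ltr_pwDl ?enorm_ge0.
have : 2 ^+ n < enorm x.
  by apply: notin_box => /asboolP /nmin; rewrite ltnn.
move=> xn; rewrite [leRHS](_ : _ = 16 ^- n :> R); last by rewrite exprS invfM mulVKf.
rewrite (_ : 16 = 2 ^+ 4 :> R); last by rewrite -natrX.
rewrite exprAC lef_pV2 ?posrE ?exprn_gt0 ?ltr_pwDl ?enorm_ge0//.
by rewrite lerXn2r ?nnegrE ?exprn_ge0 ?addr_ge0 ?enorm_ge0// ltW// ltr_wpDl.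
Qed.

Lemma loc_integrable_measurable (f : cfun R) : loc_integrable f ->
  cmeasurable (f : mspace -> R[i]).
Proof.
move=> fl; rewrite /cmeasurable -bigcup_box; split.
  apply/measurable_fun_bigcup => [n|n]; first exact: measurable_box.
  have [/integrableP[/measurable_EFinP mf _] _] := fl _ (@compact_box n%:R).
  exact: mf.
apply/measurable_fun_bigcup => [n|n]; first exact: measurable_box.
have [_ /integrableP[/measurable_EFinP mf _]] := fl _ (@compact_box n%:R).
exact: mf.
Qed.

End MeasureOnSpace.

(** * Schwartz functions *)

Section Schwartz.
Variable R : realType.
Local Notation space := (Defs.space R).
Local Notation mR := (measurableTypeR R).
Local Notation mspace := (mR * mR * mR)%type.
Local Notation mu := (mu3 R).

Lemma line_lipschitz (f : space -> R) (v : space) (C : R) :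
  (forall x, derivable f x v) -> (forall x, `|'D_v f x| <= C) ->
  forall x s, `|f (x + s *: v) - f x| <= C * `|s|.
Proof.
move=> df fC.
have pos x s : 0 <= s -> `|f (x + s *: v) - f x| <= C * s.
  move=> s0; pose g (t : R) := f (x + t *: v).
  have dg (t : R) : is_derive t (1 : R) g ('D_v f (x + t *: v)).
    have E : (fun h : R => h^-1 *: ((g \o shift t) (h *: 1) - g t)) =
        (fun h : R => h^-1 *: ((f \o shift (x + t *: v)) (h *: v) - f (x + t *: v))).
      apply/funext => h; rewrite /g /=; congr (_ *: (f _ - _)).
      by rewrite [h *: 1]mulr1 scalerDl addrCA.
    by split; [rewrite /derivable E; exact: df|rewrite /derive E].
  have [|c _ gE] := @MVT_segment R g (fun t => 'D_v f (x + t *: v)) 0 s s0 (fun t _ => dg t).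
    apply: continuous_subspaceT => t.
    by apply: differentiable_continuous; apply/derivable1_diffP; have [] := dg t.
  have -> : f (x + s *: v) - f x = g s - g 0 by rewrite /g scale0r addr0.
  by rewrite gE subr0 normrM (ger0_norm s0) ler_wpM2r.
move=> x s; have [s0|s0] := leP 0 s; first by rewrite (ger0_norm s0) pos.
rewrite (ltr0_norm s0) distrC.
have := pos (x + s *: v) (- s); rewrite -addrA -scalerDl subrr scale0r addr0.
by apply; rewrite oppr_ge0 ltW.
Qed.

(** The l^1 distance, suited to paths that follow one axis at a time. *)
Definition ldist (x y : space) : R :=
  `|x.1.1 - y.1.1| + `|x.1.2 - y.1.2| + `|x.2 - y.2|.

(** One coordinate is changed at a time, so that only partial derivatives enter. *)
Lemma space_lipschitz (f : space -> R) (C : R) :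
  (forall x j, derivable f x (unitv R j)) ->
  (forall x j, `|'D_(unitv R j) f x| <= C) ->
  forall x y, `|f x - f y| <= C * ldist x y.
Proof.
move=> df fC [[x1 x2] x3] [[y1 y2] y3]; rewrite /ldist/=.
have h j := line_lipschitz (fun x => df x j) (fun x => fC x j).
have := h 0 (y1, y2, y3) (x1 - y1); have := h 1 (x1, y2, y3) (x2 - y2).
have := h ord_max (x1, x2, y3) (x3 - y3).
rewrite (_ : (x1, x2, y3) + _ = (x1, x2, x3)); last first.
  by congr (_, _, _); rewrite /= /GRing.scale/= ?mulr0 ?addr0// mulr1 subrKC.
rewrite (_ : (x1, y2, y3) + _ = (x1, x2, y3)); last first.
  by congr (_, _, _); rewrite /= /GRing.scale/= ?mulr0 ?addr0// mulr1 subrKC.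
rewrite (_ : (y1, y2, y3) + _ = (x1, y2, y3)); last first.
  by congr (_, _, _); rewrite /= /GRing.scale/= ?mulr0 ?addr0// mulr1 subrKC.
move=> h3 h2 h1; rewrite !mulrDr.
rewrite (_ : f _ - _ = (f (x1, y2, y3) - f (y1, y2, y3)) +
  (f (x1, x2, y3) - f (x1, y2, y3)) + (f (x1, x2, x3) - f (x1, x2, y3))); last by ring.
by rewrite (le_trans (ler_normD _ _))// lerD// (le_trans (ler_normD _ _))// lerD.
Qed.

Lemma measurable_ldist (y : space) :
  measurable_fun [set: mspace] (fun x : mspace => ldist x y).
Proof.
have mc j : measurable_fun [set: mspace] (fun x : mspace => `|coord x j - coord y j|).
  apply: (measurableT_comp (@normr_measurable R setT)).
  exact: measurable_funB (measurable_coord j) (measurable_cst _).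
exact: measurable_funD (measurable_funD (mc 0) (mc 1)) (mc ord_max).
Qed.

Definition ratpt (q : rat * rat * rat) : space :=
  (ratr q.1.1, ratr q.1.2, ratr q.2).

Lemma ratpt_dense (x : space) (e : R) : 0 < e ->
  exists q, ldist x (ratpt q) < e.
Proof.
move=> e0.
have app (t : R) : {q : rat | `|t - ratr q| < e / 3}.
  apply/cid; have [|q] := @rat_in_itvoo R (t - e / 3) (t + e / 3); first lra.
  by rewrite in_itv/= => /andP[? ?]; exists q; rewrite ltr_norml; apply/andP; split; lra.
have [q1 h1] := app x.1.1; have [q2 h2] := app x.1.2; have [q3 h3] := app x.2.
by exists (q1, q2, q3); rewrite /ldist/=; lra.
Qed.

Lemma measurable_ldist_lt (y : space) (e : R) :
  measurable [set x : mspace | ldist x y < e].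
Proof.
rewrite (_ : [set x | _] = [set: mspace] `&` (fun x : mspace => ldist x y) @^-1` `]-oo, e[).
  exact: measurable_ldist.
by apply/seteqP; split => [x /=|x [_] /=]; rewrite in_itv/=.
Qed.

Lemma ldist_ball (x y z : space) (e : R) :
  ldist x z < e / 2 -> ldist y z < e / 2 -> ball x e y.
Proof.
move: x y z => [[x1 x2] x3] [[y1 y2] y3] [[z1 z2] z3]; rewrite /ldist/= => xz yz.
have h (a b c : R) : `|a - c| < e / 2 -> `|b - c| < e / 2 -> `|a - b| < e.
  by rewrite !ltr_norml => /andP[? ?] /andP[? ?]; apply/andP; split; lra.
have := (normr_ge0 (x1 - z1), normr_ge0 (x2 - z2), normr_ge0 (x3 - z3)).
have := (normr_ge0 (y1 - z1), normr_ge0 (y2 - z2), normr_ge0 (y3 - z3)).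
move=> [[? ?] ?] [[? ?] ?].
by split; [split|]; [apply: (h _ _ z1)|apply: (h _ _ z2)|apply: (h _ _ z3)]; lra.
Qed.

(** An open set is the union of the countably many l^1 balls with rational centre and radius 1/(n+1)
    that it contains. This links the topology of the space to its product sigma-algebra. *)
Lemma open_measurable_space (U : set space) : open U -> measurable (U : set mspace).
Proof.
move=> oU.
pose cell (qn : (rat * rat * rat) * nat) : set mspace :=
  [set x | ldist x (ratpt qn.1) < qn.2.+1%:R^-1].
rewrite (_ : (U : set mspace) =
    \bigcup_qn (if `[< cell qn `<=` U >] then cell qn else set0)).
  apply: countable_bigcupT_measurable => [|qn]; first exact: countableP.
  by case: ifP => _; [exact: measurable_ldist_lt|exact: measurable0].
apply/seteqP; split=> [x Ux|x [qn _]]; last by case: ifPn => // /asboolP; apply.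
have [e /= e0 xeU] : exists2 e : R, 0 < e & ball x e `<=` U.
  by apply/nbhs_ballP; move: oU; rewrite openE; apply.
pose n := Num.bound (2 / e).
have ne : n.+1%:R^-1 < e / 2.
  rewrite invf_plt ?posrE ?divr_gt0// invf_div.
  by rewrite (lt_trans (archi_boundP _)) ?divr_ge0 ?ltW// ltr_nat.
have n0 : 0 < n.+1%:R^-1 :> R by rewrite invr_gt0.
have [q xq] := ratpt_dense x n0.
exists (q, n) => //; case: ifPn => // /asboolPn; apply => y /= yq.
by apply: xeU; apply: (@ldist_ball _ _ (ratpt q)); exact: lt_trans ne.
Qed.

(** [loc_integrable] ranges over compact sets, and additivity of integrals over them requires their
    measurability. *)
Lemma compact_measurable_space (K : set space) :
  compact K -> measurable (K : set mspace).
Proof.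
move=> /(compact_closed _) cK; rewrite -[K]setCK; apply: measurableC.
apply: open_measurable_space; apply: closed_openC; apply: cK.
exact: norm_hausdorff.
Qed.

(** A Lipschitz function is the supremum of the downward cones f(q) - C * ldist x q with rational
    apex q, so {f > a} is a countable union of measurable sets. *)
Lemma lipschitz_measurable (f : space -> R) (C : R) : 0 <= C ->
  (forall x y, `|f x - f y| <= C * ldist x y) ->
  measurable_fun [set: mspace] (f : mspace -> R).
Proof.
move=> C0 fC mT; apply: (measurability _ (RGenOInfty.measurableE R)) => //.
move=> /= _ [_ [a ->] <-]; rewrite setTI.
rewrite (_ : _ @^-1` _ = \bigcup_q [set x : mspace | a < f (ratpt q) - C * ldist x (ratpt q)]).
  apply: countable_bigcupT_measurable => [|q]; first exact: countableP.
  have mL : measurable_fun [set: mspace] (fun x : mspace => f (ratpt q) - C * ldist x (ratpt q)).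
    apply: measurable_funB => //; apply: measurable_funM => //.
    exact: measurable_ldist.
  rewrite -[X in measurable X]setTI (_ : [set x | _] =
     (fun x : mspace => f (ratpt q) - C * ldist x (ratpt q)) @^-1` `]a, +oo[); first exact: mL.
  by apply/seteqP; split => x /=; rewrite in_itv/= andbT.
apply/seteqP; split=> [x /=|x [q _ /=]]; rewrite in_itv/= andbT => ax; last first.
  by have := fC x (ratpt q); rewrite ler_norml => /andP[+ _]; lra.
(* Makes C * ldist at most (f x - a) / 4 for an apex within 3 e of x. This quantity is lost twice,
   in passing from f(x) to f(q) and along the cone. The summand 1 covers C = 0. *)
pose e := (f x - a) / (12 * (C + 1)).
have e0 : 0 < e by rewrite divr_gt0 ?subr_gt0// mulr_gt0// ltr_wpDl.
have [q dq] := ratpt_dense x (mulr_gt0 (ltr0n R 3) e0).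
exists q => //=.
have Cd : C * ldist x (ratpt q) <= (C + 1) * (3 * e).
  by apply: ler_pM => //; [rewrite !addr_ge0|rewrite lerDl|exact: ltW dq].
have Ce : (C + 1) * (3 * e) = (f x - a) / 4.
  by rewrite /e; field; rewrite gt_eqF// ltr_wpDl.
have := fC x (ratpt q); rewrite ler_norml => /andP[_ ub]; lra.
Qed.

Lemma Re_Im_le_normc (z : R[i]) :
  `|Re z| <= ComplexField.Normc.normc z /\ `|Im z| <= ComplexField.Normc.normc z.
Proof.
case: z => a b /=; rewrite -2!sqrtr_sqr !ler_sqrt ?addr_ge0 ?sqr_ge0//.
by rewrite lerDl lerDr !sqr_ge0.
Qed.

Lemma schwartz_bound (phi : cfun R) N : schwartz phi ->
  exists2 C : R, 0 <= C & forall s x, (size s <= N)%N ->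
    (1 + enorm x) ^+ N * ComplexField.Normc.normc (partials s phi x) <= C.
Proof.
move=> [_ /(_ N) phioo].
have ge s x : (size s <= N)%N -> (((1 + enorm x) ^+ N *
    ComplexField.Normc.normc (partials s phi x))%:E <= seminorm N phi)%E.
  by move=> sN; apply: ereal_sup_ubound; exists s, x.
have ge0 s x : 0 <= (1 + enorm x) ^+ N * ComplexField.Normc.normc (partials s phi x).
  rewrite mulr_ge0 ?exprn_ge0 ?addr_ge0 ?enorm_ge0//.
  by rewrite (le_trans _ (Re_Im_le_normc _).1).
have fin : seminorm N phi \is a fin_num.
  rewrite fin_numE -ltey phioo andbT -ltNye.
  by apply: lt_le_trans (ge [::] 0 _) => //; rewrite ltNyr.
exists (fine (seminorm N phi)) => [|s x sN].
  by rewrite -lee_fin fineK//; apply: le_trans (ge [::] 0 _); rewrite ?lee_fin ?ge0.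
by rewrite -lee_fin fineK// ge.
Qed.

(** The seminorm of order one bounds the first partial derivatives, so the real and imaginary parts
    are Lipschitz. *)
Lemma schwartz_measurable (phi : cfun R) : schwartz phi ->
  cmeasurable (phi : mspace -> R[i]).
Proof.
move=> sphi; have [C C0 phiC] := @schwartz_bound phi 1 sphi.
have [smooth_phi _] := sphi.
have dC x j : ComplexField.Normc.normc (partials [:: j] phi x) <= C.
  apply: le_trans (phiC [:: j] x isT); rewrite expr1 ler_peMl//.
    by rewrite (le_trans _ (Re_Im_le_normc _).1).
  by rewrite lerDl enorm_ge0.
split; apply: (lipschitz_measurable C0); apply: space_lipschitz => x j.
- by have [] := smooth_phi [::] j x.
- exact: le_trans (Re_Im_le_normc _).1 (dC x j).
- by have [] := smooth_phi [::] j x.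
- exact: le_trans (Re_Im_le_normc _).2 (dC x j).
Qed.

Lemma schwartz_decay (phi : cfun R) : schwartz phi ->
  exists2 C : R, 0 <= C & forall x,
    `|Re (phi x)| <= C * (1 + enorm x) ^- 4 /\
    `|Im (phi x)| <= C * (1 + enorm x) ^- 4.
Proof.
move=> sphi; have [C C0 phiC] := @schwartz_bound phi 4 sphi.
exists C => // x; have e0 : 0 < (1 + enorm x) ^+ 4.
  by rewrite exprn_gt0// ltr_pwDl// enorm_ge0.
have := phiC [::] x isT; rewrite mulrC -ler_pdivlMr//= => le.
by split; [apply: le_trans (Re_Im_le_normc _).1 le|apply: le_trans (Re_Im_le_normc _).2 le].
Qed.

End Schwartz.

(** * Pseudomeasures and convolutions *)

Section PseudoMeasureBounds.
Variable R : realType.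
Local Notation space := (Defs.space R).
Local Notation mR := (measurableTypeR R).
Local Notation mspace := (mR * mR * mR)%type.
Local Notation mu := (mu3 R).

Lemma pm_normP (a c : R) (g : cvfun R) : (pm_norm a g <= c%:E)%E <->
  {ae mu, forall x, enorm x `^ a * cnorm (g x) <= c}.
Proof. by split=> [/ess_supP//|gc]; apply/ess_supP. Qed.

Lemma pm_norm2P (c : R) (g : cvfun R) : (pm_norm 2 g <= c%:E)%E <->
  {ae mu, forall x, enorm x ^+ 2 * cnorm (g x) <= c}.
Proof.
rewrite pm_normP.
by split; apply: filterS => x; rewrite powR_mulrn ?enorm_ge0.
Qed.

Lemma pm_norm0P (c : R) (g : cvfun R) : (pm_norm 0 g <= c%:E)%E <->
  {ae mu, forall x, cnorm (g x) <= c}.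
Proof.
by rewrite pm_normP; split; apply: filterS => x; rewrite powRr0 mul1r.
Qed.

(** Over a null space an essential supremum would be -oo; this gives [pm_norm_ge0]. *)
Lemma mu3_setT_gt0 : (0 < mu [set: mspace])%E.
Proof.
have : (mu (box 1) <= mu [set: mspace])%E.
  by apply: le_measure => //; rewrite inE; [exact: measurable_box|exact: measurableT].
by apply: lt_le_trans; rewrite mu3_box// lte_fin mulr1 exprn_gt0.
Qed.

Lemma pm_norm_ge0 (a : R) (g : cvfun R) : (0 <= pm_norm a g)%E.
Proof.
apply: ess_sup_gee; first exact: mu3_setT_gt0.
by apply: aeW => x; rewrite lee_fin mulr_ge0 ?powR_ge0 ?cnorm_ge0.
Qed.

Lemma pm_fin_num (a : R) (u : PM a) : pm_norm a (hat u) \is a fin_num.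
Proof. by rewrite ge0_fin_numE ?pm_norm_ge0// pm_finite. Qed.

(** Discards the frequency at which the Leray symbol and the division by |xi|^2 degenerate; the
    origin is the cube of half-side 0. *)
Lemma ae_neq0 : {ae mu, forall x : space, x != 0}.
Proof.
exists (box 0); split; first exact: measurable_box.
  by rewrite mu3_box// mulr0 expr0n.
move=> x /= /negP; rewrite negbK => /eqP ->; apply: in_box => j.
by rewrite (_ : coord 0 j = 0) ?normr0//; elim/ord3P: j.
Qed.

Lemma hat_measurable (a : R) (u : PM a) j :
  cmeasurable ((hat u ^~ j) : mspace -> R[i]).
Proof. exact: loc_integrable_measurable (pm_loc_integrable u j). Qed.

Lemma cintegrable_le (f : space -> R[i]) (b : space -> R) :
  cmeasurable (f : mspace -> R[i]) ->
  mu.-integrable setT (EFin \o b) ->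
  {ae mu, forall x, `|Re (f x)| <= b x /\ `|Im (f x)| <= b x} ->
  cintegrable mu setT f.
Proof.
move=> [mre mim] bi fb; split.
  by apply: (ae_le_integrable _ mre bi) => //; apply: filterS fb => x [].
by apply: (ae_le_integrable _ mim bi) => //; apply: filterS fb => x [].
Qed.

Definition cabs1 (z : R[i]) : R := `|Re z| + `|Im z|.

Lemma cabs1_ge0 z : 0 <= cabs1 z. Proof. by rewrite addr_ge0. Qed.

Lemma cabs1_le_cnorm (z : 'I_3 -> R[i]) j : cabs1 (z j) <= 2 * cnorm z.
Proof. by rewrite mulr_natl mulr2n lerD// (Re_le_cnorm, Im_le_cnorm). Qed.

Lemma Re_Im_mul_le (z w : R[i]) (K : R) : `|Re w| <= K -> `|Im w| <= K ->
  `|Re (z * w)| <= K * cabs1 z /\ `|Im (z * w)| <= K * cabs1 z.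
Proof.
case: z w => a b [c d] /= cK dK; split.
  rewrite (le_trans (ler_normB _ _))// !normrM mulrDr lerD// mulrC ler_wpM2r//.
rewrite (le_trans (ler_normD _ _))// !normrM mulrDr lerD// mulrC ler_wpM2r//.
Qed.

(** Dominating functions are built in two pieces: on a cube around the origin local integrability is
    used, outside it the weighted bound. *)
Definition near_part (a : R) (u : PM a) (j : 'I_3) (r : R) (x : space) : R :=
  \1_(box r) x * cabs1 (hat u x j).

Lemma near_part_ge0 a (u : PM a) j r x : 0 <= near_part u j r x.
Proof. by rewrite mulr_ge0// cabs1_ge0. Qed.

Lemma integrable_near_part a (u : PM a) j r :
  mu.-integrable setT (EFin \o near_part u j r).
Proof.
have [h1 h2] := pm_loc_integrable u j (@compact_box R r).
have := integrableDR (@measurable_box R r) (integrable_norm h1) (integrable_norm h2).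
move/(integrable_mkcond _ (@measurable_box R r)).
apply: eq_integrable => // x _; rewrite /near_part /= patchE indicE.
by case: ifPn => _; rewrite ?mul1r ?mul0r.
Qed.

Lemma box_enorm r (x : space) : box r x -> enorm x <= 3 * r.
Proof.
move=> [[]] /=; rewrite !in_itv/= -!ler_norml => x1 x2 x3.
by rewrite (le_trans (enorm_le_sum _))//; lra.
Qed.

(** Inside the unit cube the decay factor is at most 1 and [hat u] is integrable; outside, |x| > 1,
    so the PM^2 bound controls [hat u] itself and the decay of phi is integrable. It makes the
    pairing in [fourier_of] additive. *)
Lemma hat_schwartz_integrable (u : PM 2) (phi : cfun R) j : schwartz phi ->
  cintegrable mu setT (fun x => hat u x j * phi x).
Proof.
move=> sphi; have [C C0 phiC] := schwartz_decay sphi.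
pose M := fine (pm_norm 2 (hat u)).
have M0 : 0 <= M by rewrite fine_ge0// pm_norm_ge0.
have uM : {ae mu, forall x, enorm x ^+ 2 * cnorm (hat u x) <= M}.
  by apply/pm_norm2P; rewrite fineK// pm_fin_num.
have mh := cmeasurableM (hat_measurable u j) (schwartz_measurable sphi).
apply: (@cintegrable_le _
  (fun x => C * near_part u j 1 x + 2 * M * C * (1 + enorm x) ^- 4)) => //.
  apply: integrableDR => //; apply: integrableZR => //.
    exact: integrable_near_part.
  exact: integrable_decay.
apply: filterS uM => x uM; have [p1 p2] := phiC x.
set d := (1 + enorm x) ^- 4 in p1 p2 *.
have d0 : 0 <= d by rewrite invr_ge0 exprn_ge0// addr_ge0// enorm_ge0.
have key : C * d * cabs1 (hat u x j) <= C * near_part u j 1 x + 2 * M * C * d.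
  rewrite /near_part indicE; have [xb|/negP xb] := boolP (x \in box 1).
    rewrite mul1r ler_wpDr ?mulr_ge0// ler_wpM2r ?cabs1_ge0// ler_piMr//.
    rewrite invf_le1 ?exprn_gt0 ?ltr_pwDl ?enorm_ge0//.
    by rewrite exprn_ege1// lerDl enorm_ge0.
  rewrite mul0r mulr0 add0r [leRHS]mulrAC [leRHS](_ : _ = C * d * (2 * M)); last by ring.
  rewrite ler_wpM2l ?mulr_ge0// (le_trans (cabs1_le_cnorm _ _))// ler_wpM2l//.
  rewrite (le_trans _ uM)// ler_peMl ?cnorm_ge0// exprn_ege1// ltW//.
  by apply: notin_box => xb'; apply: xb; rewrite inE.
by have [r1 r2] := Re_Im_mul_le (hat u x j) p1 p2; split; exact: le_trans key.
Qed.

End PseudoMeasureBounds.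

(** * Differences of pseudomeasures and integrability of convolutions *)

Section PseudoMeasureAlgebra.
Variable R : realType.
Local Notation space := (Defs.space R).
Local Notation mR := (measurableTypeR R).
Local Notation mspace := (mR * mR * mR)%type.
Local Notation mu := (mu3 R).

Lemma le_seminorm (M N : nat) (phi : cfun R) : (M <= N)%N ->
  (seminorm M phi <= seminorm N phi)%E.
Proof.
move=> MN; apply: ge_ereal_sup => _ [s [x [sM ->]]].
apply: (@le_trans _ _ ((1 + enorm x) ^+ N *
    ComplexField.Normc.normc (partials s phi x))%:E).
  rewrite lee_fin ler_wpM2r//; first by rewrite (le_trans _ (Re_Im_le_normc _).1).
  by rewrite ler_weXn2l// lerDl enorm_ge0.
by apply: ereal_sup_ubound; exists s, x; split => //; exact: leq_trans MN.
Qed.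

Lemma seminorm_ge0 N (phi : cfun R) : (0 <= seminorm N phi)%E.
Proof.
apply: (@le_trans _ _ ((1 + enorm (0 : space)) ^+ N *
    ComplexField.Normc.normc (partials [::] phi 0))%:E).
  rewrite lee_fin mulr_ge0 ?exprn_ge0 ?addr_ge0 ?enorm_ge0//.
  by rewrite (le_trans _ (Re_Im_le_normc _).1).
by apply: ereal_sup_ubound; exists [::], 0.
Qed.

Lemma temperedB (S T : functional R) : tempered S -> tempered T ->
  tempered (fun phi => S phi - T phi).
Proof.
move=> [linS [M [C SC]]] [linT [N [D TD]]]; split.
  by move=> c phi psi sphi spsi; rewrite linS// linT// mulrBr opprD addrACA.
(* Absolute values, as the definition of [tempered] does not fix the signs of C and D. *)
exists (maxn M N), (`|C| + `|D|) => phi sphi.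
set s := seminorm (maxn M N) phi.
have sS : ((ComplexField.Normc.normc (S phi))%:E <= `|C|%:E * s)%E.
  apply: le_trans (SC _ sphi) _; apply: (@le_trans _ _ (`|C|%:E * seminorm M phi)%E).
    by rewrite lee_wpmul2r ?seminorm_ge0// lee_fin ler_norm.
  by rewrite lee_wpmul2l ?lee_fin// le_seminorm// leq_maxl.
have sT : ((ComplexField.Normc.normc (T phi))%:E <= `|D|%:E * s)%E.
  apply: le_trans (TD _ sphi) _; apply: (@le_trans _ _ (`|D|%:E * seminorm N phi)%E).
    by rewrite lee_wpmul2r ?seminorm_ge0// lee_fin ler_norm.
  by rewrite lee_wpmul2l ?lee_fin// le_seminorm// leq_maxr.
rewrite EFinD ge0_muleDl ?lee_fin//.
apply: le_trans (leeD sS sT); rewrite -EFinD lee_fin.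
apply: le_trans (@le_normcD R (S phi) (- T phi)) _; rewrite lerD2l.
by case: (T phi) => a b /=; rewrite !sqrrN.
Qed.

Lemma enorm2_le_pm (u : PM (2 : R)) : {ae mu, forall x,
  enorm x ^+ 2 * cnorm (hat u x) <= fine (pm_norm 2 (hat u))}.
Proof. by apply/pm_norm2P; rewrite fineK// pm_fin_num. Qed.

Lemma pm_normB_le (u v : PM (2 : R)) a b : (pm_norm 2 (hat u) <= a%:E)%E ->
  (pm_norm 2 (hat v) <= b%:E)%E ->
  (pm_norm 2 (subv (hat u) (hat v)) <= (a + b)%:E)%E.
Proof.
move=> /pm_norm2P ua /pm_norm2P vb; apply/pm_norm2P.
apply: filterS2 ua vb => x ua vb; apply: le_trans (lerD ua vb).
by rewrite -mulrDr ler_wpM2l ?exprn_ge0 ?enorm_ge0// cnormB.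
Qed.

(** [bilin_bound] speaks of elements of [PM 2] only, so it applies to a difference once a
    distribution with that Fourier transform is provided. *)
Lemma pm_sub (u v : PM (2 : R)) :
  exists w : PM (2 : R), hat w = subv (hat u) (hat v).
Proof.
have t j := temperedB (pm_tempered u j) (pm_tempered v j).
have l j : loc_integrable (fun x => subv (hat u) (hat v) x j).
  move=> K cK; have [u1 u2] := pm_loc_integrable u j cK.
  have [v1 v2] := pm_loc_integrable v j cK.
  have mK : measurable (K : set mspace) by exact: compact_measurable_space.
  exact: cintegrableB (conj u1 u2) (conj v1 v2).
have f j : fourier_of (fun phi => dist u j phi - dist v j phi)
    (fun x => subv (hat u) (hat v) x j).
  move=> phi sphi; rewrite !pm_fourier// -cintegralB//;
    try exact: hat_schwartz_integrable.
  by apply: eq_cintegral => // x _; rewrite mulrBl.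
have fin : (pm_norm 2 (subv (hat u) (hat v)) < +oo)%E.
  apply: le_lt_trans (ltry (fine (pm_norm 2 (hat u)) + fine (pm_norm 2 (hat v)))).
  by apply: pm_normB_le; rewrite fineK// pm_fin_num.
by exists (MkPM t l f fin).
Qed.

(* Near y = 0 the factor at xi - y is bounded, near y = xi the factor at y is,
   and away from both points the product decays like |y|^-4. *)
Lemma convolution_integrable (u v : PM (2 : R)) k j (xi : space) : xi != 0 ->
  cintegrable mu setT (fun y => hat u (xi - y) k * hat v y j).
Proof.
move=> xi0; have e0 := enorm_gt0 xi0.
(* A cube of half-side r lies in the ball of radius 3 r = |xi| / 2, so when one of y and xi - y is
   in it the other has norm at least 3 r, where K bounds the corresponding factor. *)
pose r := enorm xi / 6; have r0 : 0 < r by rewrite divr_gt0.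
pose M := Num.max (fine (pm_norm 2 (hat u))) (fine (pm_norm 2 (hat v))).
have uM : {ae mu, forall x, enorm x ^+ 2 * cnorm (hat u x) <= M}.
  by apply: filterS (enorm2_le_pm u) => x /le_trans; apply; rewrite le_max lexx.
have vM : {ae mu, forall x, enorm x ^+ 2 * cnorm (hat v x) <= M}.
  by apply: filterS (enorm2_le_pm v) => x /le_trans; apply; rewrite le_max lexx orbT.
have M0 : 0 <= M by rewrite le_max !fine_ge0// pm_norm_ge0.
pose K := M / (3 * r) ^+ 2; have K0 : 0 <= K by rewrite divr_ge0// exprn_ge0// mulr_ge0// ltW.
(* Far from both points: 2 compares [cabs1] with [cnorm], M^2 comes from the two weighted bounds, 49
   = 7^2 from |y| <= |xi - y| + 6 r <= 7 |xi - y|, and the last factor from 1 + |y| <= (1 + 1/r)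
   |y|. *)
pose C := 2 * M ^+ 2 * 49 * (1 + r^-1) ^+ 4.
have C0 : 0 <= C by rewrite !mulr_ge0// ?exprn_ge0// addr_ge0// invr_ge0 ltW.
have mu_refl : cmeasurable ((fun y => hat u (xi - y) k) : mspace -> R[i]).
  exact: (cmeasurable_comp (measurable_reflect xi) (hat_measurable u k)).
have mh := cmeasurableM mu_refl (hat_measurable v j).
apply: (@cintegrable_le _ _ (fun y => K * near_part v j r y +
  K * near_part u k r (xi - y) + C * (1 + enorm y) ^- 4)) => //.
  apply: integrableDR => //; [apply: integrableDR => //|]; apply: integrableZR => //.
  - exact: integrable_near_part.
  - by apply: (integrable_reflect xi); exact: integrable_near_part.
  - exact: integrable_decay.
have far x (z : 'I_3 -> R[i]) : 3 * r <= enorm x -> enorm x ^+ 2 * cnorm z <= M ->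
    cnorm z <= K.
  move=> rx zM; rewrite /K ler_pdivlMr ?exprn_gt0 ?mulr_gt0//.
  rewrite mulrC (le_trans _ zM)// ler_wpM2r ?cnorm_ge0//.
  by rewrite lerXn2r ?nnegrE ?enorm_ge0// mulr_ge0// ltW.
apply: filterS2 (ae_reflect xi uM) vM => y uxy vy.
have ex : enorm xi = 6 * r by rewrite /r; field.
have tri : enorm xi <= enorm (xi - y) + enorm y := enorm_sub_le _ _.
set s := _ + _ + _.
have ub1 w : cnorm (hat u (xi - y)) * cabs1 (hat v y j) <= w ->
    `|Re (hat u (xi - y) k * hat v y j)| <= w /\
    `|Im (hat u (xi - y) k * hat v y j)| <= w.
  move=> le; rewrite mulrC.
  have [] := Re_Im_mul_le (hat v y j) (Re_le_cnorm (hat u (xi - y)) k)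
    (Im_le_cnorm (hat u (xi - y)) k).
  by move=> h1 h2; split; [exact: le_trans h1 le|exact: le_trans h2 le].
have ub2 w : cnorm (hat v y) * cabs1 (hat u (xi - y) k) <= w ->
    `|Re (hat u (xi - y) k * hat v y j)| <= w /\
    `|Im (hat u (xi - y) k * hat v y j)| <= w.
  move=> le.
  have [] := Re_Im_mul_le (hat u (xi - y) k) (Re_le_cnorm (hat v y) j)
    (Im_le_cnorm (hat v y) j).
  by move=> h1 h2; split; [exact: le_trans h1 le|exact: le_trans h2 le].
have d0 : 0 <= C * (1 + enorm y) ^- 4.
  by rewrite mulr_ge0// invr_ge0 exprn_ge0// addr_ge0// enorm_ge0.
have [yb|/negP yb] := boolP (y \in box r).
  apply: ub1; have ey := box_enorm (set_mem yb).
  rewrite /s {1}/near_part indicE yb mul1r -addrA ler_wpDr//.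
    by rewrite addr_ge0// mulr_ge0// near_part_ge0.
  by rewrite ler_wpM2r ?cabs1_ge0//; apply: (far (xi - y)) => //; lra.
have [zb|/negP zb] := boolP (xi - y \in box r).
  apply: ub2; have ey := box_enorm (set_mem zb).
  rewrite /s [X in _ + K * X + _]/near_part indicE zb mul1r addrAC ler_wpDl//.
    by rewrite addr_ge0// mulr_ge0// near_part_ge0.
  by rewrite ler_wpM2r ?cabs1_ge0//; apply: (far y) => //; lra.
have ey : r < enorm y by apply: notin_box => /mem_set.
have ez : r < enorm (xi - y) by apply: notin_box => /mem_set.
apply: ub1; rewrite /s ler_wpDl//.
  by rewrite addr_ge0// mulr_ge0// near_part_ge0.
rewrite (le_trans (ler_wpM2l (cnorm_ge0 _) (cabs1_le_cnorm _ _)))//.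
have ez7 : enorm y <= 7 * enorm (xi - y).
  have := enorm_sub_le y xi.
  have -> : enorm (y - xi) = enorm (xi - y).
    by rewrite !enorm_cnorm -cnormN; congr cnorm; apply/funext => i;
      rewrite -rmorphN/= !coordB opprB.
  lra.
have e1 : 1 + enorm y <= (1 + r^-1) * enorm y.
  by rewrite mulrDl mul1r addrC lerD2l -ler_pdivrMl ?invr_gt0// invrK mulr1 ltW.
have y0 := lt_trans r0 ey; have z0 := lt_trans r0 ez.
rewrite ler_pdivlMr ?exprn_gt0 ?ltr_pwDl ?enorm_ge0//.
have h4 : (1 + enorm y) ^+ 4 <= (1 + r^-1) ^+ 4 * enorm y ^+ 4.
  have a0 : 0 <= 1 + enorm y by rewrite addr_ge0// enorm_ge0.
  by rewrite -exprMn lerXn2r// nnegrE//; exact: le_trans e1.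
have h5 : enorm y ^+ 4 <= 49 * (enorm (xi - y) ^+ 2 * enorm y ^+ 2).
  rewrite (_ : 4%N = (2 + 2)%N)// exprD mulrA ler_wpM2r ?exprn_ge0 ?enorm_ge0//.
  rewrite (_ : 49 = 7 ^+ 2); last by rewrite -natrX.
  by rewrite -exprMn lerXn2r ?nnegrE ?mulr_ge0 ?enorm_ge0.
set p := cnorm (hat u _) in uxy *; set q := cnorm (hat v y) in vy *.
have p0 : 0 <= p by exact: cnorm_ge0. have q0 : 0 <= q by exact: cnorm_ge0.
apply: (@le_trans _ _ (p * (2 * q) * ((1 + r^-1) ^+ 4 * (49 * (enorm (xi - y) ^+ 2 * enorm y ^+ 2))))).
  rewrite ler_wpM2l ?mulr_ge0// (le_trans h4)// ler_wpM2l// exprn_ge0// addr_ge0// invr_ge0 ltW//.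
rewrite /C [leLHS](_ : _ = 2 * (enorm (xi - y) ^+ 2 * p * (enorm y ^+ 2 * q)) * 49 * (1 + r^-1) ^+ 4); last by ring.
rewrite ler_wpM2r ?exprn_ge0 ?addr_ge0 ?invr_ge0 ?(ltW r0)// ler_wpM2r// ler_wpM2l//.
by rewrite [M ^+ 2]expr2; apply: ler_pM => //; rewrite mulr_ge0 ?exprn_ge0 ?enorm_ge0.
Qed.

End PseudoMeasureAlgebra.

(** * The bilinear operator *)

Section HeatIntegral.
Variable R : realType.
Local Notation space := (Defs.space R).
Local Notation mR := (measurableTypeR R).
Local Notation mspace := (mR * mR * mR)%type.
Local Notation leb := (@lebesgue_measure R).
Local Notation mu := (mu3 R).

Definition heat_kernel (a t tau : R) : R := expR (- (t - tau) * a).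

Lemma is_derive_heat_kernel (a t x : R) : a != 0 ->
  is_derive x (1 : R) (fun x => heat_kernel a t x / a) (heat_kernel a t x).
Proof.
move=> a0; rewrite /heat_kernel.
have -> : (fun x0 : R => expR (- (t - x0) * a) / a) =
    (fun x0 => a^-1 * (expR \o (fun y => a * y - a * t)) x0).
  by apply/funext => y /=; rewrite mulrC; congr (_ * expR _); ring.
apply: is_derive_eq.
rewrite /= /GRing.scale/= (_ : - (t - x) * a = a * x - a * t); last by ring.
by field.
Qed.

Lemma continuous_heat_kernel (a t : R) : continuous (heat_kernel a t).
Proof.
move=> x; apply: (@continuous_comp _ _ _ (fun y : R => - (t - y) * a) expR); last exact: continuous_expR.
apply: cvgM; last exact: cvg_cst.
by apply: cvgN; apply: cvgB; [exact: cvg_cst|exact: cvg_id].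
Qed.

Lemma integrable_heat_kernel (a s t : R) :
  leb.-integrable `[0, s] (EFin \o heat_kernel a t).
Proof.
apply: continuous_compact_integrable; first exact: segment_compact.
by apply: continuous_subspaceT => x; exact: continuous_heat_kernel.
Qed.

(** The upper limit [s] is kept apart from [t]: s = t gives the whole Duhamel integral, s < t its
    initial layer. *)
Lemma Rintegral_heat_kernel (a s t : R) : 0 < a -> 0 <= s ->
  Rintegral leb `[0, s] (heat_kernel a t) =
  (heat_kernel a t s - heat_kernel a t 0) / a.
Proof.
move=> a0; rewrite le_eqVlt => /predU1P[<-|s0].
  by rewrite set_itv1 Rintegral_set1 subrr mul0r.
have d x := @is_derive_heat_kernel a t x (lt0r_neq0 a0).
have c : continuous (fun x => heat_kernel a t x / a).
  move=> x; apply: differentiable_continuous; apply/derivable1_diffP.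
  by have [] := d x.
rewrite /Rintegral (@continuous_FTC2 R _ (fun x => heat_kernel a t x / a))//.
- by rewrite -EFinB/= mulrBl.
- by apply: continuous_subspaceT; exact: continuous_heat_kernel.
- split.
  + by move=> x _; have [] := d x.
  + exact: cvg_at_right_filter (c _).
  + exact: cvg_at_left_filter (c _).
- by move=> x _; rewrite derive1E; have [_ ->] := d x.
Qed.

Lemma heat_symbolE (t tau : R) (xi : space) :
  heat_symbol (t - tau) xi = (heat_kernel (enorm xi ^+ 2) t tau)%:C.
Proof. by []. Qed.

Lemma cintegral_heat_cst (t : R) (xi : space) (z : R[i]) : xi != 0 -> 0 <= t ->
  cintegral leb `[0, t] (fun tau => heat_symbol (t - tau) xi * z) =
  ((1 - expR (- t * enorm xi ^+ 2)) / enorm xi ^+ 2)%:C * z.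
Proof.
move=> xi0 t0; have e0 : 0 < enorm xi ^+ 2 by rewrite exprn_gt0// enorm_gt0.
have hi := @integrable_heat_kernel (enorm xi ^+ 2) t t.
rewrite (@eq_cintegral _ _ _ _ _ _ (fun tau : mR => z * (heat_kernel (enorm xi ^+ 2) t tau)%:C)); last first.
  by move=> tau _; rewrite heat_symbolE mulrC.
rewrite cintegralZ//; last by split => //; exact: integrable0.
rewrite mulrC; congr (_ * z); rewrite /cintegral/= Rintegral_heat_kernel//.
rewrite {2}/heat_kernel subr0 /heat_kernel subrr oppr0 mul0r expR0.
by rewrite /Rintegral integral0.
Qed.

End HeatIntegral.

Section BilinearBound.
Variable R : realType.
Local Notation space := (Defs.space R).
Local Notation mR := (measurableTypeR R).
Local Notation mspace := (mR * mR * mR)%type.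
Local Notation mu := (mu3 R).

(** Allows [bilin_bound] to be tested on time-independent fields. *)
Lemma Cw_cst (a : R) (u : PM a) : Cw (fun=> u).
Proof.
split.
- exists (fine (pm_norm a (hat u))) => t _.
  by rewrite fineK ?pm_fin_num.
- by move=> j phi _; split; apply: continuous_subspaceT => t; exact: cvg_cst.
- move=> j; have [h1 h2] := hat_measurable u j; split; apply: measurable_funTS.
    exact: (measurableT_comp h1 measurable_snd).
  exact: (measurableT_comp h2 measurable_snd).
Qed.

Lemma Cw_norm_cst_le (a b : R) (u : PM a) : (pm_norm a (hat u) <= b%:E)%E ->
  (Cw_norm a (hats (fun=> u)) <= b%:E)%E.
Proof. by move=> ub; apply: ge_ereal_sup => _ [t _ <-]. Qed.

Lemma Cw_norm_ge0 (a : R) (g : R -> cvfun R) : (0 <= Cw_norm a g)%E.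
Proof.
apply: le_trans (pm_norm_ge0 a (g 0)) _; apply: ereal_sup_ubound.
by exists 0 => //=; rewrite in_itv/= lexx.
Qed.

Lemma pm_norm_le_Cw (a t : R) (g : R -> cvfun R) : 0 <= t ->
  (pm_norm a (g t) <= Cw_norm a g)%E.
Proof.
by move=> t0; apply: ereal_sup_ubound; exists t => //=; rewrite in_itv/= t0.
Qed.

(* On time-independent fields B(u,v)(t) is (1 - e^{-t|xi|^2}) / |xi|^2 times
   the symbol below, so letting t go to infinity turns the bound on B into a
   pointwise one with the same constant. *)
Lemma bilin_bound_pointwise (eta a b : R) (u v : PM (2 : R)) :
  0 <= eta -> bilin_bound eta ->
  (pm_norm 2 (hat u) <= a%:E)%E -> (pm_norm 2 (hat v) <= b%:E)%E ->
  {ae mu, forall xi,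
    cnorm (leray (div_tensor_hat (hat u) (hat v)) xi) <= eta * (a * b)}.
Proof.
move=> eta0 bb ua vb.
have := bb _ _ (Cw_cst u) (Cw_cst v); set g := bilin_hat _ _ => gle.
have gK : (Cw_norm 2 g <= (eta * (a * b))%:E)%E.
  apply: le_trans gle _; rewrite !EFinM lee_wpmul2l ?lee_fin//.
  by apply: lee_pmul; rewrite ?Cw_norm_ge0 ?Cw_norm_cst_le.
(* Integer times suffice, and they leave only countably many null sets to discard. *)
have h : {ae mu, forall xi, forall n : nat,
    enorm xi ^+ 2 * cnorm (g n%:R xi) <= eta * (a * b)}.
  apply/ae_foralln => n; apply/pm_norm2P.
  by apply: le_trans gK; exact: pm_norm_le_Cw.
apply: filterS2 (ae_neq0 R) h => xi xi0 h.
set z := leray _ _; set K := eta * _ in h *.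
have e0 : 0 < enorm xi ^+ 2 by rewrite exprn_gt0// enorm_gt0.
set e := enorm xi ^+ 2 in e0 h *.
have gE n : cnorm (g n%:R xi) = (1 - expR (- n%:R * e)) / e * cnorm z.
  have c0 : 0 <= (1 - expR (- n%:R * e)) / e.
    by rewrite divr_ge0 ?(ltW e0)// subr_ge0 -expR0 ler_expR mulNr oppr_le0 mulr_ge0// ltW.
  rewrite -[X in X * _](ger0_norm c0) -cnormZ -cnormN; congr cnorm.
  apply/funext => j; rewrite /g /bilin_hat opprK /duhamel.
  exact: (@cintegral_heat_cst _ _ _ (z j) xi0 (ler0n R n)).
(* From exp(x) >= 1 + x follows 1 - exp(-x) >= x / (1 + x) for x >= 0, which turns the limit in time
   into an algebraic inequality. *)
have hn n : n%:R * e * cnorm z <= K * (1 + n%:R * e).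
  have := h n; rewrite gE mulrA mulrCA divff ?gt_eqF// mulr1 => hn.
  have p0 : 0 < 1 + n%:R * e by rewrite ltr_pwDl// mulr_ge0// ltW.
  rewrite -ler_pdivrMr// (le_trans _ hn)// mulrAC ler_wpM2r ?cnorm_ge0//.
  rewrite lerBrDr -lerBrDl mulNr expRN.
  rewrite (_ : 1 - _ = (1 + n%:R * e)^-1); last by field; rewrite gt_eqF.
  by rewrite lef_pV2 ?posrE ?expR_gt0 ?expR_ge1Dx.
rewrite leNgt; apply/negP => Kz.
(* If K < |z|, the previous inequality bounds n |xi|^2 (|z| - K) by K for every n; this n violates
   it. *)
pose n := Num.bound (K / (e * (cnorm z - K))).
have zK : 0 < cnorm z - K by rewrite subr_gt0.
have K0 : 0 <= K by rewrite (le_trans _ (h 0%N))// mulr_ge0 ?(ltW e0)// cnorm_ge0.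
have := archi_boundP (divr_ge0 K0 (ltW (mulr_gt0 e0 zK))).
rewrite -/n ltr_pdivrMr; last exact: mulr_gt0.
move=> nb.
have := hn n; lra.
Qed.

End BilinearBound.

(** * Duhamel integrals *)

Section JointMeasurability.
Variable R : realType.
Local Notation space := (Defs.space R).
Local Notation mR := (measurableTypeR R).
Local Notation mspace := (mR * mR * mR)%type.
Local Notation leb := (@lebesgue_measure R).
Local Notation mu := (mu3 R).

Definition jmeasurable (f : R -> cvfun R) :=
  forall j, cmeasurable (fun p : mR * mspace => f p.1 p.2 j).

(** [Cw] gives measurability for nonnegative times only; composing with [clamp] extends it to the
    whole line and changes no Duhamel integral. *)
Definition clamp (t : R) : R := Num.max t 0.

Lemma clamp_ge0 t : 0 <= clamp t. Proof. by rewrite le_max lexx orbT. Qed.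

Lemma clamp_id t : 0 <= t -> clamp t = t. Proof. by move=> t0; exact/max_l. Qed.

Lemma jmeasurable_hat (a : R) (u : R -> PM a) : Cw u ->
  jmeasurable (fun t => hat (u (clamp t))).
Proof.
move=> [_ _ mu_] j; have [h1 h2] := mu_ j.
pose h (p : mR * mspace) : mR * mspace := (clamp p.1, p.2).
have mh : measurable_fun setT h.
  apply/measurable_fun_pairP; split; last exact: measurable_snd.
  exact: measurable_maxr (measurable_fst) (measurable_cst _).
have mD : measurable ([set p | 0 <= p.1] : set (mR * mspace)).
  rewrite (_ : [set p | _] = setT `&` fst @^-1` `[(0:R), +oo[).
    by apply: measurable_fst => //; exact: measurable_itv.
  by apply/seteqP; split => [p /=|p [_] /=]; rewrite in_itv/= andbT.
have hD : h @` setT `<=` [set p | 0 <= p.1] by move=> _ [p _ <-]; exact: clamp_ge0.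
split.
  exact: (measurable_comp mD hD (h1 : measurable_fun
    ([set p | 0 <= p.1] : set (mR * mspace)) _) mh).
exact: (measurable_comp mD hD (h2 : measurable_fun
    ([set p | 0 <= p.1] : set (mR * mspace)) _) mh).
Qed.

Lemma jmeasurable_cst (a : R) (u : PM a) : jmeasurable (fun=> hat u).
Proof. by move=> j; exact: (cmeasurable_comp measurable_snd (hat_measurable u j)). Qed.

Lemma jmeasurable_div_tensor (g h : R -> cvfun R) :
  jmeasurable g -> jmeasurable h ->
  jmeasurable (fun t => div_tensor_hat (g t) (h t)).
Proof.
move=> mg mh j; apply: cmeasurable_sum3 => k; apply: cmeasurableM.
  have mc : measurable_fun setT (fun p : mR * mspace => coord p.2 k).
    exact: (measurableT_comp (measurable_coord k) measurable_snd).
  by split => //=; exact: measurable_cst.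
apply: cmeasurableM; first exact: cmeasurable_cst.
(* With z = ((t, xi), y), the maps [q] and [r] read off (t, xi - y) and (t, y), so the convolution
   becomes a parametric integral in y. *)
pose q (z : mR * mspace * mspace) : mR * mspace := (z.1.1, (z.1.2 - z.2 : space)).
pose r (z : mR * mspace * mspace) : mR * mspace := (z.1.1, z.2).
have m11 : measurable_fun setT (fun z : mR * mspace * mspace => z.1.1).
  exact: (measurableT_comp measurable_fst measurable_fst).
have mr : measurable_fun setT r.
  by apply/measurable_fun_pairP; split => //; exact: measurable_snd.
have mq : measurable_fun setT q.
  apply/measurable_fun_pairP; split => //.
  have mc i : measurable_fun setT
      (fun z : mR * mspace * mspace => coord z.1.2 i - coord z.2 i).
    apply: measurable_funB; last exact: (measurableT_comp (measurable_coord i) measurable_snd).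
    apply: (measurableT_comp (measurable_coord i)).
    exact: (measurableT_comp measurable_snd measurable_fst).
  by apply/measurable_fun_pairP; split; [apply/measurable_fun_pairP; split|];
    [exact: (mc 0)|exact: (mc 1)|exact: (mc ord_max)].
apply: (@cmeasurable_cintegral _ _ (mR * mspace)%type mspace R (vol R)
  (fun z => g z.1.1 (z.1.2 - z.2 : space) k * h z.1.1 z.2 j)).
apply: cmeasurableM.
  exact: (cmeasurable_comp mq (mg k)).
exact: (cmeasurable_comp mr (mh j)).
Qed.

Lemma measurable_leray_symbol j k :
  measurable_fun [set: mspace] (fun x : mspace => leray_symbol x j k).
Proof.
rewrite /leray_symbol; apply: measurable_funB => //.
apply: measurable_funM; first by apply: measurable_funM; exact: measurable_coord.
rewrite (_ : (fun x => _) = fun x : mspace => (enorm x ^+ 2) `^ (-1)); last first.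
  by apply/funext => x; rewrite powR_inv1// exprn_ge0// enorm_ge0.
apply: (measurableT_comp (measurable_powR _)).
by apply: measurable_funX; exact: measurable_enorm.
Qed.

Lemma jmeasurable_leray (g : R -> cvfun R) :
  jmeasurable g -> jmeasurable (fun t => leray (g t)).
Proof.
move=> mg j; apply: cmeasurable_sum3 => k; apply: cmeasurableM => //.
apply: cmeasurable_real.
exact: (measurableT_comp (measurable_leray_symbol j k) measurable_snd).
Qed.

Lemma jmeasurableB (f g : R -> cvfun R) : jmeasurable f -> jmeasurable g ->
  jmeasurable (fun t => subv (f t) (g t)).
Proof. by move=> mf mg j; exact: cmeasurableB (mf j) (mg j). Qed.

(** The exceptional null set of frequencies may vary with t, and the union over all t need not be
    null; Tonelli gives instead, for almost every xi, a bound at almost every time, as time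
    integrals at fixed xi require. *)
Lemma jmeasurable_ae_le (f : R -> cvfun R) (b : R -> R) :
  measurable_fun [set: mR] (b : mR -> R) -> jmeasurable f ->
  (forall t, {ae mu, forall xi, cnorm (f t xi) <= b t}) ->
  {ae mu, forall xi, {ae leb, forall t, cnorm (f t xi) <= b t}}.
Proof.
move=> mb mf fb.
pose A : set (mR * mspace) := [set p | ~ (cnorm (f p.1 p.2) <= b p.1)].
have mA : measurable A.
  rewrite [A](_ : _ = ~` [set p : mR * mspace | cnorm (f p.1 p.2) <= b p.1])//.
  apply: measurableC; rewrite -[X in measurable X]setTI; apply: measurable_fun_le => //.
    exact: measurable_cnorm.
  exact: (measurableT_comp mb measurable_fst).
have sw : {ae mu, forall xi, {ae leb, forall t, ~ A (t, xi)}}.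
  apply: (@ae_ae_swap _ _ mR mspace R leb (vol R) A mA); apply: aeW => t.
  have : {ae mu, forall xi, ~ A (t, xi)}.
    by apply: filterS (fb t) => xi le /=.
  exact.
by apply: filterS sw => xi; apply: filterS => t /contrapT.
Qed.

End JointMeasurability.

(** * The Leray symbol and differences of products *)

Section SymbolAlgebra.
Variable R : realType.
Local Notation space := (Defs.space R).
Local Notation mu := (mu3 R).

Lemma leray_symbol_le (xi : space) j k : xi != 0 -> `|leray_symbol xi j k| <= 2.
Proof.
move=> xi0; have e0 := enorm_gt0 xi0.
rewrite (le_trans (ler_normB _ _))// (_ : 2 = 1 + 1 :> R)//; apply: lerD.
  by case: (j == k); rewrite ?normr1 ?normr0.
rewrite !normrM normfV (ger0_norm (exprn_ge0 2 (enorm_ge0 xi))).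
rewrite ler_pdivrMr ?exprn_gt0// mul1r expr2.
by apply: ler_pM => //; exact: coord_le_enorm.
Qed.

(* The symbol is an orthogonal projection; this crude constant suffices. *)
Lemma cnorm_leray_le (g : cvfun R) (xi : space) : xi != 0 ->
  cnorm (leray g xi) <= 36 * cnorm (g xi).
Proof.
move=> xi0; rewrite (le_trans (cnorm_le_sum _))//.
(* Three matrix entries of size at most 2 give 6 for each of the real and imaginary parts; the three
   components then give 36. *)
have jb j : `|Re (leray g xi j)| + `|Im (leray g xi j)| <= 12 * cnorm (g xi).
  have kb k : 2 * `|Re (g xi k)| <= 2 * cnorm (g xi) /\
      2 * `|Im (g xi k)| <= 2 * cnorm (g xi).
    by rewrite !ler_pM2l// Re_le_cnorm Im_le_cnorm.
  have sk (z : R[i]) (s : R) : `|s| <= 2 ->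
      `|Re (s%:C * z)| <= 2 * `|Re z| /\ `|Im (s%:C * z)| <= 2 * `|Im z|.
    by case: z => x y s2 /=; rewrite !mul0r subr0 addr0 !normrM !ler_wpM2r.
  have lk k := sk (g xi k) _ (leray_symbol_le j k xi0).
  rewrite /leray !raddf_sum/= (_ : 12 = 6 + 6 :> R); last by rewrite -natrD.
  rewrite mulrDl; apply: lerD.
    rewrite (le_trans (ler_norm_sum _ _ _))// (le_trans (ler_sum _ (fun k _ => le_trans (lk k).1 (kb k).1)))//.
    by rewrite sumr_const card_ord -mulr_natl; lra.
  rewrite (le_trans (ler_norm_sum _ _ _))// (le_trans (ler_sum _ (fun k _ => le_trans (lk k).2 (kb k).2)))//.
  by rewrite sumr_const card_ord -mulr_natl; lra.
rewrite (le_trans (ler_sum _ (fun j _ => jb j)))//.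
by rewrite sumr_const card_ord -mulr_natl; lra.
Qed.

Lemma lerayB (f g : cvfun R) (xi : space) j :
  leray (subv f g) xi j = leray f xi j - leray g xi j.
Proof. by rewrite /leray -sumrB; apply: eq_bigr => k _; rewrite /subv mulrBr. Qed.

(** The two cross terms u (x) v cancel; splitting the integrals relies on [convolution_integrable],
    hence xi != 0. *)
Lemma div_tensor_hat_diff (u v w : PM (2 : R)) (xi : space) j :
  xi != 0 -> hat w = subv (hat v) (hat u) ->
  leray (div_tensor_hat (hat v) (hat v)) xi j
    - leray (div_tensor_hat (hat u) (hat u)) xi j =
  leray (div_tensor_hat (hat w) (hat v)) xi j
    + leray (div_tensor_hat (hat u) (hat w)) xi j.
Proof.
move=> xi0 wE; rewrite -lerayB /leray -big_split/=; apply: eq_bigr => k _.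
rewrite -mulrDr; congr (_ * _); rewrite /subv /div_tensor_hat -sumrB -big_split/=.
apply: eq_bigr => i _; rewrite -mulrBr -mulrDr; congr (_ * _).
rewrite /tensor_hat -mulrBr -mulrDr; congr (_ * _).
have vv := convolution_integrable v v i k xi0.
have uv := convolution_integrable u v i k xi0.
have uu := convolution_integrable u u i k xi0.
rewrite (_ : (fun y => hat w _ _ * _) = (fun y => hat v (xi - y) i * hat v y k -
   hat u (xi - y) i * hat v y k)); last first.
  by apply/funext => y; rewrite wE /subv mulrBl.
rewrite (_ : (fun y => hat u _ _ * hat w _ _) = (fun y => hat u (xi - y) i * hat v y k -
   hat u (xi - y) i * hat u y k)); last first.
  by apply/funext => y; rewrite wE /subv mulrBr.
by rewrite !cintegralB// addrA subrK.
Qed.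

End SymbolAlgebra.

Section DuhamelEstimate.
Variable R : realType.
Local Notation space := (Defs.space R).
Local Notation mR := (measurableTypeR R).
Local Notation leb := (@lebesgue_measure R).
Local Notation mu := (mu3 R).

(** For almost every xi the integrand is dominated by K times the heat kernel, which is continuous
    on the compact interval. *)
Lemma time_cintegrable (f : R -> cvfun R) (K t : R) : jmeasurable f ->
  (forall tau, {ae mu, forall xi, cnorm (f tau xi) <= K}) ->
  {ae mu, forall xi, forall j, cintegrable leb `[0, t]
    (fun tau => heat_symbol (t - tau) xi * f tau xi j)}.
Proof.
move=> mf fK.
have := @jmeasurable_ae_le R f (cst K) (measurable_cst _) mf fK.
apply: filterS => xi aeK j.
pose hk := heat_kernel (enorm xi ^+ 2) t.
have hk0 tau : 0 <= hk tau by exact: expR_ge0.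
have [m1 m2] : cmeasurable ((fun tau => heat_symbol (t - tau) xi * f tau xi j) : mR -> R[i]).
  apply: cmeasurableM.
    by apply: cmeasurable_real; apply: continuous_measurable_fun; exact: continuous_heat_kernel.
  exact: (cmeasurable_comp (pair2_measurable xi) (mf j)).
have bi : leb.-integrable `[0, t] (EFin \o (fun tau => K * hk tau)).
  by apply: integrableZR => //; exact: integrable_heat_kernel.
have reim tau : (Re (heat_symbol (t - tau) xi * f tau xi j) = hk tau * Re (f tau xi j)) *
    (Im (heat_symbol (t - tau) xi * f tau xi j) = hk tau * Im (f tau xi j)).
  by rewrite heat_symbolE; case: (f tau xi j) => x y /=; rewrite !mul0r subr0 addr0.
split; apply: (ae_le_integrable _ _ bi) => //; try exact: measurable_funTS.
  apply: filterS aeK => tau le _; rewrite reim normrM ger0_norm// mulrC ler_wpM2r//.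
  exact: le_trans (Re_le_cnorm _ _) le.
apply: filterS aeK => tau le _; rewrite reim normrM ger0_norm// mulrC ler_wpM2r//.
exact: le_trans (Im_le_cnorm _ _) le.
Qed.

(* The initial layer [0, s] contributes at most
   K (e^{-(t-s)|xi|^2} - e^{-t|xi|^2}) <= K s |xi|^2 e^{-(t-s)|xi|^2}. *)
Lemma cnorm_duhamel_le (H : R -> 'I_3 -> R[i]) (xi : space) (s t b K : R) :
  xi != 0 -> 0 <= s -> s < t -> 0 <= b -> 0 <= K ->
  (forall j, cintegrable leb `[0, t]
    (fun tau => heat_symbol (t - tau) xi * H tau j)) ->
  {ae leb, forall tau, cnorm (H tau) <= b + K * (tau <= s)%R%:R} ->
  enorm xi ^+ 2 * cnorm (fun j => cintegral leb `[0, t]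
    (fun tau => heat_symbol (t - tau) xi * H tau j)) <= b + K * s / (t - s).
Proof.
move=> xi0 s0 st b0 K0 Hi Hb.
have e0 : 0 < enorm xi ^+ 2 by rewrite exprn_gt0// enorm_gt0.
set e := enorm xi ^+ 2 in e0 *.
have t0 : 0 <= t by rewrite (le_trans s0)// ltW.
pose hk := heat_kernel e t.
have hk0 tau : 0 <= hk tau by exact: expR_ge0.
pose hs : R -> R := hk \_ `[0, s].
have hki : leb.-integrable `[0, t] (EFin \o hk) by exact: integrable_heat_kernel.
have hsi : leb.-integrable `[0, t] (EFin \o hs).
  have := @integrable_heat_kernel R e s t.
  have ms : measurable (`[0, s]%classic : set mR) by exact: measurable_itv.
  move/(integrable_mkcond _ ms); rewrite -restrict_EFin.
  exact: integrableS.
have bnd : cnorm (fun j => cintegral leb `[0, t]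
    (fun tau => heat_symbol (t - tau) xi * H tau j)) <=
    Rintegral leb `[0, t] (fun tau => b * hk tau + K * hs tau).
  apply: (@cnorm_cintegral_le _ _ _ leb _ _
    (fun tau j => heat_symbol (t - tau) xi * H tau j)) => //.
    by apply: integrableDR => //; exact: integrableZR.
  apply: filterS Hb => tau Hb; rewrite /= in_itv/= => /andP[tau0 _].
  rewrite heat_symbolE cnormZ ger0_norm//.
  rewrite (le_trans (ler_wpM2l (hk0 tau) Hb))// mulrDr mulrC lerD2l /hs patchE.
  rewrite mulrCA mem_setE in_itv/= tau0/=.
  by case: (tau <= s); rewrite ?mulr1 ?mulr0.
(* The weight |xi|^2 is factored out to cancel the factor 1/|xi|^2 produced by the time integral of
   the kernel. *)
have -> : b + K * s / (t - s) = e * (b / e + K * (s / (e * (t - s)))).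
  by field; rewrite subr_eq0 !gt_eqF.
rewrite ler_pM2l// (le_trans bnd)// RintegralD//; try exact: integrableZR.
rewrite !RintegralZl// /hs -Rintegral_mkcondr.
rewrite (_ : `[0, t] `&` `[0, s] = `[0, s]%classic); last first.
  apply/seteqP; split => [x [] //|x]; rewrite /= !in_itv/= => /andP[x0 xs].
  by rewrite x0 xs (le_trans xs)// ltW.
rewrite !Rintegral_heat_kernel//; apply: lerD.
  rewrite ler_wpM2l// ler_piMl ?invr_ge0 ?(ltW e0)// /heat_kernel subrr oppr0 mul0r expR0.
  by rewrite lerBlDr lerDl expR_ge0.
rewrite ler_wpM2l// ler_pdivrMr//.
have -> : s / (e * (t - s)) * e = s / (t - s) by field; rewrite subr_eq0 !gt_eqF.
pose x := (t - s) * e; have x0 : 0 < x by rewrite mulr_gt0// subr_gt0.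
have -> : heat_kernel e t s - heat_kernel e t 0 = expR (- x) * (1 - expR (- (s * e))).
  rewrite /heat_kernel mulrBr mulr1 -expRD; congr (expR _ - expR _); rewrite /x; ring.
(* The layer is at most s |xi|^2 exp(-x) with x = (t - s) |xi|^2; then exp(-x) <= 1/x removes |xi|^2
   and makes the bound uniform in xi. *)
have h1 : 1 - expR (- (s * e)) <= s * e by have := expR_ge1Dx (- (s * e)); lra.
have h2 : expR (- x) <= x^-1.
  by rewrite expRN lef_pV2 ?posrE ?expR_gt0// (le_trans _ (expR_ge1Dx x))// lerDr.
rewrite (le_trans (ler_wpM2l (expR_ge0 _) h1))//.
rewrite (le_trans (ler_wpM2r (mulr_ge0 s0 (ltW e0)) h2))//.
rewrite le_eqVlt; apply/orP; left; apply/eqP; rewrite /x.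
by field; rewrite subr_eq0 !gt_eqF.
Qed.

Lemma duhamel_clamp (f : R -> cvfun R) t xi j :
  duhamel f t xi j = cintegral leb `[0, t]
    (fun tau => heat_symbol (t - tau) xi * leray (f (clamp tau)) xi j).
Proof.
apply: eq_cintegral => // tau; rewrite /= in_itv/= => /andP[tau0 _].
by rewrite clamp_id.
Qed.

End DuhamelEstimate.

(** * Convergence to the stationary solution *)

Section Stability.
Variable R : realType.
Local Notation space := (Defs.space R).
Local Notation mR := (measurableTypeR R).
Local Notation leb := (@lebesgue_measure R).
Local Notation mu := (mu3 R).

Lemma cvg_near_le (f : R -> \bar R) (c : R) : f t @[t --> +oo%R] --> 0%E ->
  0 < c -> \forall t \near +oo%R, (f t <= c%:E)%E.
Proof.
move=> f0 c0; have : nbhs (0%E : \bar R) [set x : \bar R | (x < c%:E)%E].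
  by apply: open_ereal_lt'; rewrite lte_fin.
move=> /f0 h; have {}h : \forall t \near +oo%R, (f t < c%:E)%E by exact: h.
by apply: filterS h => t /ltW.
Qed.

Lemma near_le_cvg (f : R -> \bar R) : (forall t, 0%E <= f t)%E ->
  (forall c, 0 < c -> \forall t \near +oo%R, (f t <= c%:E)%E) ->
  f t @[t --> +oo%R] --> 0%E.
Proof.
move=> f0 fc.
have fin c t : (f t <= c%:E)%E -> f t \is a fin_num.
  by move=> ftc; rewrite ge0_fin_numE// (le_lt_trans ftc)// ltry.
apply/fine_cvgP; split; first by apply: filterS (fc 1 ltr01) => t /fin.
apply/cvgrPdist_le => c c0; apply: filterS (fc c c0) => t ftc /=.
rewrite sub0r normrN ger0_norm ?fine_ge0//.
by rewrite -lee_fin fineK// (fin c).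
Qed.

Lemma pm_normB0_le (g h : cvfun R) a b : (pm_norm 0 g <= a%:E)%E ->
  (pm_norm 0 h <= b%:E)%E -> (pm_norm 0 (subv g h) <= (a + b)%:E)%E.
Proof.
move=> /pm_norm0P ga /pm_norm0P hb; apply/pm_norm0P.
apply: filterS2 ga hb => x ga hb; exact: le_trans (cnormB _ _) (lerD ga hb).
Qed.

Section Step.
Variables (eta eps : R) (F : PM (0 : R)) (u_oo v0 : PM (2 : R)).
Variables (G : R -> PM (0 : R)) (v : R -> PM (2 : R)).
Hypotheses (eta0 : 0 < eta) (bb : bilin_bound eta) (eps0 : 0 < eps).
Hypothesis su : ns_stationary F u_oo.
Hypothesis ub : (pm_norm 2 (hat u_oo) <= (2 * eps)%:E)%E.
Hypothesis CwG : Cw G.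
Hypothesis sv : ns_solution v0 G v.
Hypothesis vb : (Cw_norm 2 (hats v) <= (2 * eps)%:E)%E.

Let ups (tau : R) : cvfun R := hat (v (clamp tau)).
Let gps (tau : R) : cvfun R := hat (G (clamp tau)).
Let convv tau := leray (div_tensor_hat (ups tau) (ups tau)).
Let convu := leray (div_tensor_hat (hat u_oo) (hat u_oo)).
(** The Duhamel integrand of the equation satisfied by v - u_oo, extended to negative times. *)
Let rhs tau := subv (subv (leray (gps tau)) (leray (hat F))) (subv (convv tau) convu).

Lemma pm_norm_v tau : 0 <= tau -> (pm_norm 2 (hat (v tau)) <= (2 * eps)%:E)%E.
Proof. by move=> tau0; apply: le_trans vb; exact: (@pm_norm_le_Cw _ 2 _ (hats v)). Qed.

(** At a fixed time each of the two products pairs the difference, of norm at most [a], with a field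
    of norm at most 2 eps, at the cost 2 eps eta a; 36 is the constant of [cnorm_leray_le]. *)
Lemma cnorm_rhs_le tau a g :
  (pm_norm 2 (subv (ups tau) (hat u_oo)) <= a%:E)%E ->
  (pm_norm 0 (subv (gps tau) (hat F)) <= g%:E)%E ->
  {ae mu, forall xi, cnorm (rhs tau xi) <= 4 * eps * eta * a + 36 * g}.
Proof.
move=> wa /pm_norm0P Gg.
have [w wE] := pm_sub (v (clamp tau)) u_oo.
have wa' : (pm_norm 2 (hat w) <= a%:E)%E by rewrite wE.
have vb' := pm_norm_v (clamp_ge0 tau).
have b1 := bilin_bound_pointwise (ltW eta0) bb wa' vb'.
have b2 := bilin_bound_pointwise (ltW eta0) bb ub wa'.
apply: filter_app Gg; apply: filter_app b1; apply: filter_app b2.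
apply: filterS (ae_neq0 R) => xi xi0 b2 b1 Gg.
have -> : rhs tau xi = fun j => leray (subv (gps tau) (hat F)) xi j -
    (leray (div_tensor_hat (hat w) (ups tau)) xi j +
     leray (div_tensor_hat (hat u_oo) (hat w)) xi j).
  apply/funext => j; rewrite /rhs {1}/subv lerayB; congr (_ - _).
  exact: div_tensor_hat_diff.
apply: le_trans (cnormB _ _) _.
apply: le_trans (lerD (cnorm_leray_le _ xi0) (cnormD _ _)) _.
rewrite (le_trans (lerD (ler_wpM2l _ Gg) (lerD b1 b2)))//.
rewrite le_eqVlt; apply/orP; left; apply/eqP; ring.
Qed.

(** Merging the four Duhamel terms under one integral requires each of them to be integrable; the
    integrability of the result is recorded for use in [cnorm_duhamel_le]. *)
Lemma solution_diff (t : R) : 0 <= t -> {ae mu, forall xi,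
  (forall j, cintegrable leb `[0, t] (fun tau => heat_symbol (t - tau) xi * rhs tau xi j)) /\
  subv (hat (v t)) (hat u_oo) xi = fun j =>
    heat t (subv (hat v0) (hat u_oo)) xi j +
    cintegral leb `[0, t] (fun tau => heat_symbol (t - tau) xi * rhs tau xi j)}.
Proof.
move=> t0.
have [_ /(_ t t0) eqv] := sv; have [_ /(_ t t0) equ] := su.
have jv : jmeasurable convv.
  have jv : jmeasurable ups by apply: jmeasurable_hat; case: sv.
  by apply: jmeasurable_leray; exact: jmeasurable_div_tensor.
have ju : jmeasurable (fun=> convu).
  by apply: jmeasurable_leray; apply: jmeasurable_div_tensor; exact: jmeasurable_cst.
have jg : jmeasurable (fun tau => leray (gps tau)).
  by apply: jmeasurable_leray; exact: jmeasurable_hat.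
have jf : jmeasurable (fun=> leray (hat F)).
  by apply: jmeasurable_leray; exact: jmeasurable_cst.
have [MG GM] : exists M : R, forall t, 0 <= t -> (pm_norm 0 (hat (G t)) <= M%:E)%E.
  by case: CwG.
have lb (g : cvfun R) (M : R) : (pm_norm 0 g <= M%:E)%E ->
    {ae mu, forall xi, cnorm (leray g xi) <= 36 * M}.
  move=> /pm_norm0P gM; apply: filterS2 (ae_neq0 R) gM => xi xi0 gM.
  by apply: le_trans (cnorm_leray_le _ xi0) _; rewrite ler_wpM2l.
have iv := time_cintegrable t jv (fun tau => bilin_bound_pointwise (ltW eta0) bb
  (pm_norm_v (clamp_ge0 tau)) (pm_norm_v (clamp_ge0 tau))).
have iu := time_cintegrable t ju (fun tau => bilin_bound_pointwise (ltW eta0) bb ub ub).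
have ig := time_cintegrable t jg (fun tau => lb _ _ (GM _ (clamp_ge0 tau))).
have fF : (pm_norm 0 (hat F) <= (fine (pm_norm 0 (hat F)))%:E)%E.
  by rewrite fineK// pm_fin_num.
have if_ := time_cintegrable t jf (fun tau => lb _ _ fF).
apply: filter_app eqv; apply: filter_app equ; apply: filter_app iv.
apply: filter_app iu; apply: filter_app ig; apply: filterS if_.
move=> xi if_ ig iu iv equ eqv.
have mI : measurable (`[0, t]%classic : set mR) by exact: measurable_itv.
have rE tau j : heat_symbol (t - tau) xi * rhs tau xi j =
    heat_symbol (t - tau) xi * leray (gps tau) xi j -
    heat_symbol (t - tau) xi * leray (hat F) xi j -
    (heat_symbol (t - tau) xi * convv tau xi j - heat_symbol (t - tau) xi * convu xi j).
  by rewrite /rhs /subv !mulrBr.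
have igf j := cintegrableB mI (ig j) (if_ j).
have ivu j := cintegrableB mI (iv j) (iu j).
have rE' j := funext (rE^~ j).
split=> [j|]; first by rewrite rE'; exact: cintegrableB.
apply/funext => j; rewrite rE' cintegralB// cintegralB// cintegralB//.
pose I (f : R -> cvfun R) := cintegral leb `[0, t]
  (fun tau => heat_symbol (t - tau) xi * f tau xi j).
have Ev : hat (v t) xi j =
    heat t (hat v0) xi j - I convv + I (fun tau => leray (gps tau)).
  by rewrite eqv /bilin_hat !duhamel_clamp.
have Eu : hat u_oo xi j =
    heat t (hat u_oo) xi j - I (fun=> convu) + I (fun=> leray (hat F)).
  by rewrite [LHS]equ /bilin_hat !duhamel_clamp.
have hE : heat t (subv (hat v0) (hat u_oo)) xi j =
    heat t (hat v0) xi j - heat t (hat u_oo) xi j by exact: mulrBr.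
have alg (a b i1 i2 i3 i4 : R[i]) :
    a - i1 + i3 - (b - i2 + i4) = a - b + (i3 - i4 - (i1 - i2)) by ring.
by rewrite {1}/subv Ev Eu hE alg.
Qed.

Hypothesis heat_cvg :
  pm_norm 2 (heat t (subv (hat v0) (hat u_oo))) @[t --> +oo%R] --> 0%E.
Hypothesis G_cvg : pm_norm 0 (subv (hat (G t)) (hat F)) @[t --> +oo%R] --> 0%E.

Let dist_at t := pm_norm 2 (subv (hat (v t)) (hat u_oo)).

Lemma jmeasurable_rhs : jmeasurable rhs.
Proof.
have jups : jmeasurable ups by apply: jmeasurable_hat; case: sv.
apply: jmeasurableB; apply: jmeasurableB; apply: jmeasurable_leray.
- exact: jmeasurable_hat.
- exact: jmeasurable_cst.
- exact: jmeasurable_div_tensor.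
- by apply: jmeasurable_div_tensor; exact: jmeasurable_cst.
Qed.

(** Starts the iteration and controls the early times in each of its steps. *)
Lemma dist_le_start t : 0 <= t -> (dist_at t <= (4 * eps)%:E)%E.
Proof.
move=> t0; have -> : 4 * eps = 2 * eps + 2 * eps by ring.
exact: pm_normB_le (pm_norm_v t0) ub.
Qed.

Lemma contraction_step (a d : R) : 0 <= a -> 0 < d ->
  (\forall t \near +oo%R, (dist_at t <= a%:E)%E) ->
  \forall t \near +oo%R, (dist_at t <= (4 * eps * eta * a + d)%:E)%E.
Proof.
move=> a0 d0 [M1 [_ aM1]].
(* The allowance d is split into thirds: force, linear evolution of the initial difference, layer
   before s. As 108 = 3 * 36, the Leray bound turns d / 108 into d / 3. *)
have [M2 [_ GM2]] := cvg_near_le G_cvg (divr_gt0 d0 (ltr0n R 108)).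
have [M3 [_ hM3]] := cvg_near_le heat_cvg (divr_gt0 d0 (ltr0n R 3)).
pose k := 4 * eps * eta.
have k0 : 0 <= k by rewrite !mulr_ge0// ltW.
have [MG GM] : exists M : R, forall t, 0 <= t -> (pm_norm 0 (hat (G t)) <= M%:E)%E.
  by case: CwG.
pose MF := fine (pm_norm 0 (hat F)).
have FM : (pm_norm 0 (hat F) <= MF%:E)%E by rewrite fineK// pm_fin_num.
have g0 : 0 <= MG + MF.
  rewrite -lee_fin; apply: le_trans (pm_normB0_le (GM 0 (lexx 0)) FM).
  exact: pm_norm_ge0.
(* Bound on [rhs] valid at all times, used before s, where neither smallness is known. *)
pose K := k * (4 * eps) + 36 * (MG + MF).
have K0 : 0 <= K by rewrite addr_ge0// mulr_ge0// mulr_ge0// ltW.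
pose b := k * a + d / 3.
have ka0 : 0 <= k * a by exact: mulr_ge0.
have b0 : 0 <= b by rewrite /b; lra.
pose s := Num.max 0 (Num.max M1 M2).
have s0 : 0 <= s by rewrite le_max lexx.
have sM1 : M1 <= s by rewrite !le_max lexx !orbT.
have sM2 : M2 <= s by rewrite !le_max lexx !orbT.
have rhs_le tau : {ae mu, forall xi, cnorm (rhs tau xi) <= b + K * (tau <= s)%R%:R}.
  have [ts|st] := leP tau s.
    have := cnorm_rhs_le (dist_le_start (clamp_ge0 tau))
      (pm_normB0_le (GM _ (clamp_ge0 tau)) FM).
    by apply: filterS => xi le; rewrite mulr1 ler_wpDl.
  have tc : clamp tau = tau by rewrite clamp_id// (le_trans s0)// ltW.
  have h1 : (pm_norm 2 (subv (ups tau) (hat u_oo)) <= a%:E)%E.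
    by rewrite /ups tc; apply: aM1; exact: le_lt_trans st.
  have h2 : (pm_norm 0 (subv (gps tau) (hat F)) <= (d / 108)%:E)%E.
    by rewrite /gps tc; apply: GM2; exact: le_lt_trans st.
  apply: filterS (cnorm_rhs_le h1 h2) => xi le.
  rewrite mulr0 addr0 (le_trans le)// /b -/k lerD2l.
  by rewrite le_eqVlt; apply/orP; left; apply/eqP; field.
have mb : measurable_fun [set: mR] ((fun tau => b + K * (tau <= s)%R%:R) : mR -> R).
  apply: measurable_funD => //; apply: measurable_funM => //.
  rewrite (_ : (fun tau => _) = \1_(`]-oo, s]%classic : set mR)); last first.
    by apply/funext => tau; rewrite indicE mem_setE in_itv.
  by apply: measurable_indic; exact: measurable_itv.
have swap := jmeasurable_ae_le mb jmeasurable_rhs rhs_le.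
(* Waiting 3 K s / d beyond s brings the layer K s / (t - s) below d / 3. *)
exists (Num.max M3 (s + 1 + 3 * K * s / d)); split; first exact: num_real.
move=> t; rewrite gt_max => /andP[M3t st].
have q0 : 0 <= 3 * K * s / d by rewrite divr_ge0 ?(ltW d0)// !mulr_ge0.
have st1 : s < t by lra.
have t0 : 0 <= t by lra.
have layer : K * s / (t - s) <= d / 3.
  rewrite ler_pdivrMr ?subr_gt0// -ler_pdivrMl ?divr_gt0//.
  have -> : (d / 3)^-1 * (K * s) = 3 * K * s / d by field; rewrite gt_eqF.
  lra.
have /pm_norm2P heat_le := hM3 t M3t.
apply/pm_norm2P.
apply: filter_app heat_le; apply: filter_app swap; apply: filter_app (solution_diff t0).
apply: filterS (ae_neq0 R) => xi xi0 [ci ->] swap heat_le.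
have e0 : 0 <= enorm xi ^+ 2 by rewrite exprn_ge0// enorm_ge0.
apply: le_trans (ler_wpM2l e0 (cnormD _ _)) _; rewrite mulrDr.
have duh := cnorm_duhamel_le xi0 s0 st1 b0 K0 ci swap.
by apply: le_trans (lerD heat_le duh) _; rewrite /b -/k; lra.
Qed.

Lemma dist_cvg0 : eps < 1 / (4 * eta) -> dist_at t @[t --> +oo%R] --> 0%E.
Proof.
move=> small; pose k := 4 * eps * eta.
have k0 : 0 <= k by rewrite !mulr_ge0// ltW.
have k1 : k < 1 by move: small; rewrite ltr_pdivlMr ?mulr_gt0// /k; lra.
apply: near_le_cvg => [t|c c0]; first exact: pm_norm_ge0.
(* Makes c / 2 the fixed point of x -> k x + d, so that n steps from 4 eps + c / 2 lead to k^n (4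
   eps) + c / 2. *)
pose d := (1 - k) * (c / 2).
have d0 : 0 < d by rewrite mulr_gt0 ?subr_gt0// divr_gt0.
(* Each step may delay the time from which the bound holds; for a given c only finitely many steps
   are taken. *)
have iterate n : \forall t \near +oo%R,
    (dist_at t <= (k ^+ n * (4 * eps) + c / 2)%:E)%E.
  elim: n => [|n IH].
    exists 0; split; first exact: num_real.
    move=> t /ltW /dist_le_start /le_trans; apply.
    by rewrite lee_fin expr0 mul1r lerDl divr_ge0// ltW.
  have an0 : 0 <= k ^+ n * (4 * eps) + c / 2.
    have := mulr_ge0 (exprn_ge0 n k0) (ltW eps0); lra.
  have := contraction_step an0 d0 IH.
  rewrite -/k (_ : k * _ + d = k ^+ n.+1 * (4 * eps) + c / 2)//.
  by rewrite /d exprS; field.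
have [n nc] : exists n, k ^+ n * (4 * eps) <= c / 2.
  have : k ^+ n * (4 * eps) @[n --> \oo] --> 0 * (4 * eps).
    by apply: cvgMl; apply: cvg_expr; rewrite ger0_norm.
  rewrite mul0r => /cvgrPdist_le /(_ (c / 2)) /(_ (divr_gt0 c0 (ltr0n R 2))).
  move=> [n _ /(_ n (leqnn n))]; rewrite sub0r normrN => h.
  by exists n; exact: le_trans (ler_norm _) h.
apply: filterS (iterate n) => t /le_trans; apply; rewrite lee_fin; lra.
Qed.

End Step.
End Stability.

Theorem corollary6p1 (R : realType) (eta eps : R)
  (F : PM (0 : R)) (u_oo : PM (2 : R))
  (v0 : PM (2 : R)) (G : R -> PM (0 : R)) (v : R -> PM (2 : R)) :
  0 < eta -> bilin_bound eta ->
  0 < eps -> eps < 1 / (4 * eta) ->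
  (pm_norm 0 (hat F) < eps%:E)%E ->
  ns_stationary F u_oo ->
  (pm_norm 2 (hat u_oo) <= (2 * eps)%:E)%E ->
  Cw G ->
  (pm_norm 2 (hat v0) + Cw_norm 0 (hats G) <= eps%:E)%E ->
  pm_norm 2 (heat t (subv (hat v0) (hat u_oo))) @[t --> +oo%R] --> 0%E ->
  pm_norm 0 (subv (hat (G t)) (hat F)) @[t --> +oo%R] --> 0%E ->
  ns_solution v0 G v ->
  (Cw_norm 2 (hats v) <= (2 * eps)%:E)%E ->
  pm_norm 2 (subv (hat (v t)) (hat u_oo)) @[t --> +oo%R] --> 0%E.
Proof.
move=> eta0 bb eps0 small _ su ub CwG _ heat_cvg G_cvg sv vb.
exact: (dist_cvg0 eta0 bb eps0 su ub CwG sv vb heat_cvg G_cvg small).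
Qed.
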